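(* Assume that the following (conjectural) formulas hold for all integers $m\ge0$ and all $T\in[-1,1]$: if $N=2m$, $$\frac{1}{D_N} \int_{\Omega_N} |P(T)|\,dV = \frac{1}{2^{2m} \binom{2m}{m}} \left( \sum_{k=0}^{m} \frac{2m-2k+1}{2m+1} \binom{2m-2k}{m-k} \binom{2k}{k} T^{2k} \right) \left( \sum_{k=0}^{m} \binom{2m-2k}{m-k} \binom{2k}{k} T^{2k} \right),$$ and if $N=2m+1$, $$\frac{1}{D_N} \int_{\Omega_N} |P(T)|\,dV = \frac{1}{2^{2m+2} \binom{2m}{m}} \left( \sum_{k=0}^{m} \frac{2m-2k+1}{2m+1} \binom{2m-2k}{m-k} \binom{2k}{k} T^{2k} \right) \left( \sum_{k=0}^{m+1} \binom{2m+2-2k}{m+1-k} \binom{2k}{k} T^{2k} \right).$$ Let $r_N$ denote the expected number of real zeros of a random polynomial in $\Omega_N$. Then, as $N\to\infty$, $$r_N\sim\frac1\pi\log N.$$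
   Context: Identify a monic real polynomial $P(x)=x^N+a_1x^{N-1}+\cdots+a_N$ with $(a_1,\dots,a_N)\in\mathbf{R}^N$; $\Omega_N\subset\mathbf{R}^N$ is the region of monic real polynomials of degree $N$ all of whose complex roots have absolute value at most $1$ ($\Omega_0$ is a point of mass $1$, with $P=1$), $dV$ is Lebesgue measure and $D_N=\mathrm{Vol}(\Omega_N)=\int_{\Omega_N}dV$. A random polynomial is chosen according to normalized Lebesgue measure on $\Omega_N$. Here $f\sim g$ means $f/g\to1$. *)

(* Defs.v *)
From HB Require Import structures.
From mathcomp Require Import all_boot all_order all_algebra.
From mathcomp Require Import complex polyrcf.
From mathcomp Require Import all_classical all_reals all_analysis.

Set Implicit Arguments.
Unset Strict Implicit.
Unset Printing Implicit Defensive.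

Import Order.TTheory GRing.Theory Num.Theory.
Import numFieldNormedType.Exports.

Local Open Scope classical_set_scope.
Local Open Scope ring_scope.

Section TupleCons.
Variable R : realType.
Local Open Scope ereal_scope.
Local Notation RT := (measurableTypeR R).
Variable n : nat.

Definition tuple_cons (p : RT * n.-tuple RT) : n.+1.-tuple RT :=
  [tuple of p.1 :: p.2].

Definition tuple_uncons (t : n.+1.-tuple RT) : RT * n.-tuple RT :=
  (thead t, [tuple of behead t]).

Lemma tuple_consK : cancel tuple_cons tuple_uncons.
Proof.
case=> x t; rewrite /tuple_uncons /tuple_cons /= theadE; congr pair.
exact/val_inj.
Qed.

Lemma tuple_unconsK : cancel tuple_uncons tuple_cons.
Proof. by move=> t; rewrite /tuple_cons /= -tuple_eta. Qed.

Lemma measurable_tuple_cons : measurable_fun [set: RT * n.-tuple RT] tuple_cons.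
Proof. exact: measurable_cons measurable_fst measurable_snd. Qed.

Lemma measurable_tuple_uncons : measurable_fun [set: n.+1.-tuple RT] tuple_uncons.
Proof.
apply: measurable_fun_pair; first exact: (measurable_tnth ord0).
exact: measurable_behead.
Qed.

Variable mu : {sigma_finite_measure set (n.-tuple RT) -> \bar R}.

Definition cons_measure : set (n.+1.-tuple RT) -> \bar R :=
  pushforward (@lebesgue_measure R \x mu) tuple_cons.

Let cons_measureE :
  cons_measure = measure_function_pushforward__canonical__measure_function_Measure
    (@lebesgue_measure R \x mu) measurable_tuple_cons
    :> (set (n.+1.-tuple RT) -> \bar R).
Proof. by []. Qed.

Let cons_measure0 : cons_measure set0 = 0.
Proof. by rewrite cons_measureE measure0. Qed.

Let cons_measure_ge0 A : 0 <= cons_measure A.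
Proof. by rewrite cons_measureE measure_ge0. Qed.

Let cons_measure_sigma_additive : semi_sigma_additive cons_measure.
Proof. rewrite cons_measureE; exact: measure_semi_sigma_additive. Qed.

HB.instance Definition _ := isMeasure.Build _ _ _ cons_measure
  cons_measure0 cons_measure_ge0 cons_measure_sigma_additive.

Let cons_measure_sigma_finite : sigma_finite setT cons_measure.
Proof.
have [F FT Ffin] : sigma_finite setT (@lebesgue_measure R \x mu).
  have /sigma_finiteP[F [TF ndF Foo]] := sigma_finiteT (@lebesgue_measure R).
  have /sigma_finiteP[G [TG ndG Goo]] := sigma_finiteT mu.
  exists (fun n => F n `*` G n).
    rewrite -setXTT TF TG predeqE => -[x y]; split.
      move=> [/= [i _ Fix] [j _ Gjy]]; exists (maxn i j) => //; split.
      - by move: x Fix; exact/subsetPset/ndF/leq_maxl.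
      - by move: y Gjy; exact/subsetPset/ndG/leq_maxr.
    by move=> [i _ []/= ? ?]; split; exists i.
  move=> k; have [? ?] := Foo k; have [? ?] := Goo k.
  split; first exact: measurableX.
  by rewrite product_measure1E// lte_mul_pinfty// ge0_fin_numE.
exists (fun i => tuple_uncons @^-1` F i).
  by rewrite -preimage_bigcup -FT preimage_setT.
move=> i; have [mFi Fi] := Ffin i; split.
  by rewrite -[X in measurable X]setTI; exact: measurable_tuple_uncons.
rewrite /cons_measure /pushforward -comp_preimage (_ : _ \o _ = id) ?preimage_id//.
by apply/funext => p /=; rewrite tuple_consK.
Qed.

HB.instance Definition _ := Measure_isSigmaFinite.Build _ _ _
  cons_measure cons_measure_sigma_finite.

End TupleCons.

Section LebesgueMeasureRn.
Variable R : realType.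
Local Open Scope ereal_scope.
Local Notation RT := (measurableTypeR R).

(* The N-fold product of the Lebesgue measure of R; R^0 has mass 1. *)
Fixpoint lebesgue_tuple N : {sigma_finite_measure set (N.-tuple RT) -> \bar R} :=
  match N with
  | 0 => dirac [tuple]
  | N'.+1 => cons_measure (lebesgue_tuple N')
  end.

Lemma lebesgue_tuple_box n (A : 'I_n -> set RT) :
  (forall i, measurable (A i)) ->
  lebesgue_tuple n [set t | forall i, A i (tnth t i)] =
  \prod_(i < n) @lebesgue_measure R (A i).
Proof.
elim: n A => [|n IH] A mA.
  by rewrite big_ord0 /= diracE mem_set// => -[].
have mbox : measurable [set t : n.-tuple RT | forall i, A (lift ord0 i) (tnth t i)].
  rewrite (_ : [set _ | _] =
    \bigcap_(i in [set: 'I_n]) ((fun t => tnth t i) @^-1` A (lift ord0 i))).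
    apply: fin_bigcap_measurable => // i _.
    by rewrite -[X in measurable X]setTI; exact: measurable_tnth.
  by apply/seteqP; split=> t H i; [move=> _|]; exact: H.
rewrite big_ord_recl -IH// -product_measure1E//.
congr product_measure1; apply/seteqP; split => -[x t] /=.
  move=> H; split; first exact: (H ord0).
  by move=> i; have := H (lift ord0 i); rewrite tnthS.
move=> [Ax At] i; case: (unliftP ord0 i) => [j|] ->; last by [].
by rewrite tnthS.
Qed.

End LebesgueMeasureRn.

Section RandomPolynomials.
Variable R : realType.
Local Notation RT := (measurableTypeR R).

(* tnth a i is the coefficient a_{i+1} of 'X^(N - (i + 1)). *)
Definition monic_poly N (a : N.-tuple R) : {poly R} :=
  'X^N + \sum_(i < N) tnth a i *: 'X^(N - i.+1).

Definition Omega N : set (N.-tuple RT) :=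
  [set a | forall z : R[i],
     root (map_poly (real_complex R) (monic_poly a)) z -> `|z| <= 1].

Definition volume_Omega N : R := fine (lebesgue_tuple R N (@Omega N)).

Definition mean_Omega N (f : N.-tuple R -> R) : R :=
  (volume_Omega N)^-1 * \int[lebesgue_tuple R N]_(a in @Omega N) f a.

(* rootsR lists every real root once; polynomials with a multiple root form a
   null set, so counting with multiplicity would give the same expectation. *)
Definition expected_real_zeros N : R :=
  mean_Omega (fun a : N.-tuple R => (size (rootsR (monic_poly a)))%:R).

End RandomPolynomials.

(* Main.v *)
(* A polynomial P of Omega_(n+1) with a real root x is ('X - x) Q with Q in
   Omega_n, and |x| <= 1. On each line {A 'X + c : c in R}, the roots are the
   solutions of c = - x A(x), so the one-dimensional area formula turns the
   number of roots into the integral over x of the modulus of the derivative of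
   x A(x) - x0 A(x0) = (x - x0) Q(x), which is |Q(x0)|. Since A |-> Q is Horner's
   scheme, a unipotent triangular map, the expected number of real zeros in degree
   n + 1 is D_n / D_(n+1) times the integral over [-1, 1] of the mean of |Q(x)|.

   For |k| < 1, 'X B + k 'X^n B(1/'X) has all its roots in the disk if and only if B
   does. Computing the determinant of this linear change of coefficients gives
   D_(n+1) / D_n = 2 / ((2 m + 1) p_m) with m = floor(n / 2), p_k = 'C(2k, k) / 4^k.

   The assumed formulas for the means thus make the expectation equal to
     sum_(k, j) (2(m-k)+1) p_(m-k) p_k p_(m'-j) p_j / (2k+2j+1),  m' in {m, m+1}.
   Here p_(m-k) and p_(m'-j) may be replaced by p_m up to a bounded error; as
   sum_j p_j / (2k+2j+1) is close to pi / 2 * p_k and (2m+1) p_m^2 to 2 / pi, what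
   remains is sum_(k <= m) p_k^2 = log m / pi + O(1). *)

Require Import Defs.
From HB Require Import structures.
From mathcomp Require Import all_boot all_order all_algebra.
From mathcomp Require Import complex polyrcf.
From mathcomp Require Import all_classical all_reals all_analysis.
From mathcomp Require Import measurable_realfun.
From mathcomp Require Import ring lra zify.

Set Implicit Arguments.
Unset Strict Implicit.
Unset Printing Implicit Defensive.

Import Order.TTheory GRing.Theory Num.Theory.
Import numFieldNormedType.Exports.

Local Open Scope classical_set_scope.
Local Open Scope ring_scope.

(** * Central binomial coefficients *)

Section CentralBinomial.
Variable R : realFieldType.
Implicit Types j k m n : nat.

(** Every change of coefficients is linear and is carried out by one-dimensional affine
    substitutions and Tonelli's theorem, never by a determinant in several variables: Horner's
    scheme translates each coefficient by a function of the earlier ones, and the Schur-Cohn map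
    mixes only the coefficients of index i and n - 1 - i. Tonelli needs [Omega] and the number of
    real roots to be measurable in the coefficients; both are described by countably many tests on
    values of the polynomial, so the roots themselves never have to depend measurably on the
    coefficients.

    In the double sum, pi / 2 and 2 / pi must cancel in the coefficient of the sum of p_k^2. That
    sum is only estimated by m + 1 at this stage, so the cancellation is needed with an error O(1 /
    m). Wallis' integrals give this as two explicit inequalities, and every later error is a
    numerical constant valid for all m > 0. *)

Definition pbin k : R := 'C(2 * k, k)%:R / 4 ^+ k.

Lemma bin_double_rec k :
  ((k.+1 * 'C(2 * k.+1, k.+1)) = 2 * (2 * k).+1 * 'C(2 * k, k))%N.
Proof.
have h1 : (k.+1 * 'C(2 * k.+1, k.+1) = 2 * k.+1 * 'C((2 * k).+1, k))%N.
  by rewrite -mul_bin_diag; congr (_ * 'C(_, _))%N; lia.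
have h2 : (k.+1 * 'C((2 * k).+1, k) = (2 * k).+1 * 'C(2 * k, k))%N.
  have := mul_bin_down (2 * k).+1 k.
  by rewrite (_ : (2 * k).+1 - k = k.+1)%N; last lia.
by rewrite h1 -mulnA h2 mulnA.
Qed.

Lemma pbin0 : pbin 0 = 1.
Proof. by rewrite /pbin muln0 bin0 expr0 divr1. Qed.

Lemma pbinS k : pbin k.+1 * (2 * k%:R + 2) = (2 * k%:R + 1) * pbin k.
Proof.
have := congr1 (fun n : nat => n%:R : R) (bin_double_rec k).
rewrite !natrM -[(k.+1)%:R]natr1 -[(2 * k).+1%:R]natr1 natrM => h.
have e : (4 ^+ k != 0 :> R) by rewrite expf_neq0// pnatr_eq0.
rewrite /pbin exprS.
apply: (mulIf e); rewrite -[RHS]mulrA divfK//.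
suff -> : 'C(2 * k.+1, k.+1)%:R / (4 * 4 ^+ k) * (2 * k%:R + 2) * 4 ^+ k =
   (k%:R + 1) * 'C(2 * k.+1, k.+1)%:R / 2 :> R by rewrite h; field.
by field; rewrite e.
Qed.

Lemma pbin_gt0 k : 0 < pbin k.
Proof.
by rewrite divr_gt0 ?exprn_gt0// ltr0n bin_gt0; lia.
Qed.

Lemma pbin_ge0 k : 0 <= pbin k. Proof. exact/ltW/pbin_gt0. Qed.

Lemma pbinSE k : pbin k.+1 = (2 * k%:R + 1) / (2 * k%:R + 2) * pbin k.
Proof.
have k0 : 0 <= k%:R :> R := ler0n _ k.
apply: (@mulIf _ (2 * k%:R + 2)); first by apply/eqP; lra.
rewrite pbinS; field; apply/eqP; lra.
Qed.

Lemma pbin_nincr m n : (m <= n)%N -> pbin n <= pbin m.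
Proof.
elim: n => [|n IH]; first by case: m.
rewrite leq_eqVlt => /predU1P[->//|/IH]; apply: le_trans.
have := pbinS n; have := pbin_gt0 n; have := ler0n R n; have := pbin_gt0 n.+1; nra.
Qed.

Lemma pbin_le1 k : pbin k <= 1.
Proof. by rewrite -pbin0; exact: pbin_nincr. Qed.

(** The coefficient of x^k in (1 - x)^(-3/2), as [pbin k] is that of (1 - x)^(-1/2). It is the
    weight in the assumed formulas, and 2 / [wbin k] is the integral of (1 - x^2)^k over [-1, 1]. *)
Definition wbin k : R := (2 * k%:R + 1) * pbin k.

Lemma wbin_gt0 k : 0 < wbin k.
Proof. by rewrite mulr_gt0 ?pbin_gt0//; have := ler0n R k; lra. Qed.

Lemma wbin_ndecr m n : (m <= n)%N -> wbin m <= wbin n.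
Proof.
elim: n => [|n IH]; first by case: m.
rewrite leq_eqVlt => /predU1P[->//|/IH] /le_trans; apply.
rewrite /wbin -natr1.
have := pbinS n; have := pbin_gt0 n; have := ler0n R n; have := pbin_gt0 n.+1; nra.
Qed.

(** The ratio w k / k does not increase, because m (2 m + 3) <= 2 (m + 1)^2. With i = m - k this is
    w (m - k) >= (1 - k / m) w m, the lower bound by which the weights of the double sum are
    replaced by w m. *)
Lemma wbin_div_nincr i m : (i <= m)%N -> i%:R * wbin m <= m%:R * wbin i.
Proof.
elim: m => [|m IH]; first by case: i.
rewrite leq_eqVlt => /predU1P[->//|im].
have {IH} := IH im => IH.
have i0 := ler0n R i; have m0 := ler0n R m.
case: i im i0 IH => [|i] im i0 IH.
  by rewrite mul0r mulr_ge0// ltW// wbin_gt0.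
have m1 : 1 <= m%:R :> R by rewrite ler1n; lia.
have h : m%:R * wbin m.+1 <= m.+1%:R * wbin m.
  rewrite /wbin -natr1.
  have := pbinS m; have := pbin_gt0 m; have := pbin_gt0 m.+1.
  set p := pbin m; set q := pbin _ => q0 p0 e.
  suff : (m%:R * ((2 * (m%:R + 1) + 1) * q)) * (2 * m%:R + 2) <=
    ((m%:R + 1) * ((2 * m%:R + 1) * p)) * (2 * m%:R + 2).
    by rewrite ler_pM2r//; lra.
  have -> : m%:R * ((2 * (m%:R + 1) + 1) * q) * (2 * m%:R + 2) =
    m%:R * (2 * m%:R + 3) * (q * (2 * m%:R + 2)) by ring.
  rewrite e; nra.
rewrite -(@ler_pM2l _ m%:R); last lra.
apply: (@le_trans _ _ (m.+1%:R * (i.+1%:R * wbin m))).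
  by rewrite mulrCA [leRHS]mulrCA ler_wpM2l.
by rewrite [leRHS]mulrCA ler_wpM2l.
Qed.

Lemma mul_pbin_ndecr i m : (i <= m)%N -> i%:R * pbin i <= m%:R * pbin m.
Proof.
elim: m => [|m IH]; first by case: i.
rewrite leq_eqVlt => /predU1P[->//|/IH] /le_trans; apply.
rewrite -natr1.
have := pbinS m; have := pbin_gt0 m; have := ler0n R m; nra.
Qed.

(** The product is 1 at k = 0, and its successive ratios (2 k + 1) (2 k + 3) / (2 k + 2)^2 are below
    1. *)
Lemma pbin_wbin_le1 k : pbin k * wbin k <= 1.
Proof.
elim: k => [|k IH]; first by rewrite /wbin pbin0; lra.
apply: le_trans IH; rewrite /wbin -[k.+1%:R]natr1.
have := pbinS k; have := pbin_gt0 k; have := pbin_gt0 k.+1; have := ler0n R k.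
set p := pbin k; set q := pbin _; set x := k%:R => x0 q0 p0 e.
rewrite -(@ler_pM2r _ ((2 * x + 2) ^+ 2)); last by nra.
have -> : q * ((2 * (x + 1) + 1) * q) * (2 * x + 2) ^+ 2 =
  (q * (2 * x + 2)) ^+ 2 * (2 * x + 3) by ring.
rewrite e.
suff : (2 * x + 1) * p ^+ 2 * ((2 * x + 1) * (2 * x + 3)) <=
  (2 * x + 1) * p ^+ 2 * (2 * x + 2) ^+ 2 by nra.
rewrite ler_wpM2l//; last nra.
by rewrite mulr_ge0 ?sqr_ge0//; lra.
Qed.

Lemma sum_pbin k : \sum_(i < k.+1) pbin i = wbin k.
Proof.
elim: k => [|k IH]; first by rewrite big_ord1 /wbin pbin0; lra.
rewrite big_ord_recr/= IH /wbin -[k.+1%:R]natr1.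
have := pbinS k; lra.
Qed.

(** The square of (1 - x)^(-1/2) is 1 / (1 - x). *)
Lemma sum_pbin_conv n : \sum_(j < n.+1) pbin (n - j) * pbin j = 1.
Proof.
elim: n => [|n IH]; first by rewrite big_ord1 pbin0 mulr1.
(* Exchanging j and m - j trades the weight 2 j for m. With the recurrence of [pbin], the sum S then
   satisfies (n + 1) S (n + 1) = n S n + S n. *)
have sym m : \sum_(j < m.+1) 2 * j%:R * (pbin (m - j) * pbin j) =
    m%:R * \sum_(j < m.+1) pbin (m - j) * pbin j.
  transitivity (\sum_(j < m.+1) j%:R * (pbin (m - j) * pbin j) +
                \sum_(j < m.+1) (m - j)%:R * (pbin (m - j) * pbin j)).
    rewrite [X in _ + X](reindex_inj rev_ord_inj)/= -big_split/=.
    apply: eq_bigr => j _; rewrite subSS.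
    have -> : (m - (m - j) = j)%N by have := ltn_ord j; lia.
    by rewrite [X in _ + _ * X]mulrC; lra.
  rewrite -big_split mulr_sumr; apply: eq_bigr => j _ /=.
  by rewrite -mulrDl -natrD subnKC// -ltnS.
have n1 : n.+1%:R != 0 :> R by rewrite pnatr_eq0.
apply: (mulfI n1); rewrite -sym mulr1 -[RHS]mulr1 -[X in _ = _ * X]IH.
rewrite big_ord_recl/= mulr0 mul0r add0r -[n.+1%:R]natr1 mulrDl mul1r -sym -big_split/=.
apply: eq_bigr => j _; rewrite /bump/= add1n subSS -[j.+1%:R]natr1.
transitivity (pbin (n - j) * (pbin j.+1 * (2 * j%:R + 2))); first by ring.
by rewrite pbinS; ring.
Qed.

End CentralBinomial.

(** * Wallis' product and the arcsine series *)

Section Wallis.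
Variable R : realType.
Implicit Types (x : R) (j k n J : nat).
Local Notation p := (pbin R).
Local Notation w := (wbin R).

Lemma le_of_derive_ge0 (f f' : R -> R) (a b : R) : a <= b ->
  (forall x, is_derive x 1 f (f' x)) ->
  (forall x, a < x < b -> 0 <= f' x) -> f a <= f b.
Proof.
move=> ab df f0.
have fd x : derivable f x 1 by have := df x => -[].
apply: (@ger0_derive1_le_cc _ f a b) => //.
- move=> x; rewrite in_itv/= => xab; rewrite derive1E.
  by have -> := @derive_val _ _ _ _ _ _ _ (df x); exact: f0.
- by apply: derivable_within_continuous => x _; exact: fd.
- by rewrite in_itv/= lexx.
- by rewrite in_itv/= lexx ab.
Qed.

Lemma sinX_fctE n : (fun t : R => sin t ^+ n) = (@sin R) ^+ n.
Proof. by apply/funext => t; rewrite fctE. Qed.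

Lemma is_derive_sinX n x :
  is_derive x 1 (fun t : R => sin t ^+ n.+1) (n.+1%:R * sin x ^+ n * cos x).
Proof. by rewrite sinX_fctE; exact: trigger_derive. Qed.

Lemma is_derive_cossin n x :
  is_derive x 1 (fun t : R => cos t * sin t ^+ n.+1)
    (n.+1%:R * sin x ^+ n - n.+2%:R * sin x ^+ n.+2).
Proof.
have d := is_derive_sinX n x.
apply: trigger_derive; rewrite /GRing.scale/=.
have := cos2Dsin2 x; rewrite -[n.+2%:R]natr1 !exprS expr0 mulr1.
set s := sin x; set c := cos x; set N := n.+1%:R; set S := s ^+ n => e.
have -> : c * (N * S * c) = N * S * (1 - s * s) by rewrite -e; ring.
ring.
Qed.

(* trigG J, trigE J and trigH J are the primitives vanishing at 0 of
   w J * sin ^ (2 J + 1), sin ^ (2 J) / p J and trigG J; comparing their values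
   at pi / 2 gives Wallis' inequalities and bounds the remainder of the arcsine
   series at 1. *)
Definition trigG J (x : R) : R := 1 - cos x * \sum_(j < J.+1) p j * sin x ^+ (2 * j).

Lemma trigGS J : trigG J.+1 = trigG J - p J.+1 \*: (fun t => cos t * sin t ^+ (2 * J.+1)).
Proof.
apply/funext => x; rewrite /trigG !fctE big_ord_recr/= mulrDr opprD addrA.
by rewrite /GRing.scale/= mulrCA.
Qed.

Lemma is_derive_trigG J x : is_derive x 1 (trigG J) (w J * sin x ^+ (2 * J).+1).
Proof.
elim: J => [|J IH].
  have -> : trigG 0 = (fun t => 1 - cos t).
    by apply/funext => t; rewrite /trigG big_ord1 pbin0 !mulr1.
  apply: trigger_derive; rewrite /wbin pbin0 muln0 expr1 /GRing.scale/=; ring.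
rewrite trigGS.
have -> : (2 * J.+1 = (2 * J).+2)%N by lia.
have d := is_derive_cossin (2 * J).+1 x.
apply: trigger_derive.
rewrite /wbin /GRing.scale/= -[(2 * J).+3%:R]natr1.
rewrite -[(2 * J).+2%:R]natr1 -[(2 * J).+1%:R]natr1 -[J.+1%:R]natr1 natrM.
set s := sin x ^+ _; set s' := sin x ^+ _.
have := pbinS R J; set q := p J.+1 => e.
have -> : (2 * J%:R + 1) * p J * s = q * (2 * J%:R + 2) * s by rewrite e.
ring.
Qed.

Lemma trigG0 J : trigG J 0 = 0.
Proof.
rewrite /trigG big_ord_recl/= cos0 sin0 expr0 pbin0 big1 ?addr0; first by ring.
by move=> i _; rewrite expr0n/= mulr0.
Qed.

Lemma trigG_pihalf J : trigG J (pi / 2) = 1.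
Proof. by rewrite /trigG cos_pihalf mul0r subr0. Qed.

Definition trigE J (x : R) : R :=
  x - cos x * \sum_(j < J) (w j)^-1 * sin x ^+ (2 * j).+1.

Lemma is_derive_trigE J x : is_derive x 1 (trigE J) ((p J)^-1 * sin x ^+ (2 * J)).
Proof.
elim: J => [|J IH].
  have -> : trigE 0 = id.
    by apply/funext => t; rewrite /trigE big_ord0 mulr0 subr0.
  by rewrite pbin0 invr1 expr0 mulr1; exact: is_derive_id.
have -> : trigE J.+1 = trigE J - (w J)^-1 \*: (fun t => cos t * sin t ^+ (2 * J).+1).
  apply/funext => t; rewrite /trigE !fctE big_ord_recr/= mulrDr opprD addrA.
  by rewrite /GRing.scale/= mulrCA.
have d := is_derive_cossin (2 * J) x.
apply: trigger_derive.
rewrite /wbin /GRing.scale/=.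
have -> : (2 * J.+1 = (2 * J).+2)%N by lia.
rewrite -[(2 * J).+2%:R]natr1 -[(2 * J).+1%:R]natr1 natrM.
set s := sin x ^+ _; set s' := sin x ^+ _.
have J0 := ler0n R J; have p0 := pbin_gt0 R J.
rewrite pbinSE; field.
by rewrite gt_eqF//=; apply/andP; split; apply/eqP; lra.
Qed.

Lemma trigE0 J : trigE J 0 = 0.
Proof.
by rewrite /trigE sin0 big1 ?mulr0 ?subr0// => i _; rewrite expr0n mulr0.
Qed.

Lemma trigE_pihalf J : trigE J (pi / 2) = pi / 2.
Proof. by rewrite /trigE cos_pihalf mul0r subr0. Qed.

Lemma sin_pihalf_bounds x : 0 < x < pi / 2 -> 0 <= sin x <= 1.
Proof. by move=> xp; rewrite sin_le1 andbT ltW// sin_gt0_pihalf. Qed.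

Lemma pihalf_ge0 : 0 <= pi / 2 :> R.
Proof. by rewrite divr_ge0// pi_ge0. Qed.

(** The integrals of sin ^ (2 k) and sin ^ (2 k + 1) over [0, pi / 2] are p k * pi / 2 and 1 / w k,
    and the first is the larger. *)
Lemma wallis_lower k : 2 / pi <= p k * w k.
Proof.
have := @le_of_derive_ge0 (fun x => p k * trigE k x - (w k)^-1 * trigG k x)
  (fun x => sin x ^+ (2 * k) - sin x ^+ (2 * k).+1) 0 (pi / 2) pihalf_ge0.
rewrite trigE0 trigG0 trigE_pihalf trigG_pihalf.
have p0 := pbin_gt0 R k; have w0 := wbin_gt0 R k; have pi0 := pi_gt0 R.
rewrite !mulr0 subrr mulr1.
have H : 0 <= p k * (pi / 2) - (w k)^-1 -> 2 / pi <= p k * w k.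
  rewrite subr_ge0 -(ler_pM2r w0) mulVf ?gt_eqF// => h.
  by rewrite ler_pdivrMr//; lra.
move=> h; apply: H; apply: h.
- move=> x; have d1 := is_derive_trigE k x; have d2 := is_derive_trigG k x.
  apply: trigger_derive; rewrite /GRing.scale/=.
  by field; rewrite !gt_eqF.
- move=> x /sin_pihalf_bounds/andP[s0 s1].
  by rewrite exprS subr_ge0 ler_piMl// exprn_ge0.
Qed.

(** Compares sin ^ (2 k - 1) with sin ^ (2 k); the factor 2 k appears because w (k - 1) = 2 k * p
    k. *)
Lemma wallis_upper k : 2 * k%:R * p k ^+ 2 <= 2 / pi.
Proof.
case: k => [|k]; first by rewrite mulr0 mul0r divr_ge0// pi_ge0.
have := @le_of_derive_ge0 (fun x => (w k)^-1 * trigG k x - p k.+1 * trigE k.+1 x)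
  (fun x => sin x ^+ (2 * k).+1 - sin x ^+ (2 * k).+2) 0 (pi / 2) pihalf_ge0.
rewrite trigE0 trigG0 trigE_pihalf trigG_pihalf.
have p0 := pbin_gt0 R k.+1; have w0 := wbin_gt0 R k; have pi0 := pi_gt0 R.
rewrite !mulr0 subrr mulr1.
have H : 0 <= (w k)^-1 - p k.+1 * (pi / 2) -> 2 * k.+1%:R * p k.+1 ^+ 2 <= 2 / pi.
  rewrite subr_ge0 -(ler_pM2r w0) mulVf ?gt_eqF// => h.
  rewrite ler_pdivlMr//; move: h; rewrite /wbin -pbinS -[k.+1%:R]natr1; nra.
move=> h; apply: H; apply: h.
- move=> x; have d1 := is_derive_trigE k.+1 x; have d2 := is_derive_trigG k x.
  apply: trigger_derive; rewrite /GRing.scale/=.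
  have -> : (2 * k.+1 = (2 * k).+2)%N by lia.
  by field; rewrite !gt_eqF.
- move=> x /sin_pihalf_bounds/andP[s0 s1].
  by rewrite [_ ^+ (2 * k).+2]exprS subr_ge0 ler_piMl// exprn_ge0.
Qed.

Definition trigH J (x : R) : R :=
  x - \sum_(j < J.+1) p j / (2 * j%:R + 1) * sin x ^+ (2 * j).+1.

Lemma is_derive_trigH J x : is_derive x 1 (trigH J) (trigG J x).
Proof.
elim: J => [|J IH].
  have -> : trigH 0 = (fun t => t - sin t).
    by apply/funext => t; rewrite /trigH big_ord1 pbin0 mulr0 add0r divr1 mul1r.
  by apply: trigger_derive; rewrite /trigG big_ord1 pbin0 expr0 !mulr1.
have -> : trigH J.+1 = trigH J -
    (p J.+1 / (2 * J.+1%:R + 1)) \*: (fun t => sin t ^+ (2 * J.+1).+1).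
  by apply/funext => t; rewrite /trigH !fctE big_ord_recr/= opprD addrA.
have d := is_derive_sinX (2 * J.+1) x.
apply: trigger_derive; rewrite trigGS !fctE /GRing.scale/=; congr (_ - _).
have J0 := ler0n R J.+1.
rewrite -[(2 * J.+1).+1%:R]natr1 natrM.
move: J0; set s := sin x ^+ _; set y := J.+1%:R => y0; set q := pbin R _.
change (q / (2 * y + 1) * ((2 * y + 1) * s * cos x) = q * (cos x * s)); field.
by apply/eqP; lra.
Qed.

Lemma trigH0 J : trigH J 0 = 0.
Proof.
by rewrite /trigH sin0 big1 ?subr0// => i _; rewrite expr0n mulr0.
Qed.

Definition arcsin_sum J : R := \sum_(j < J.+1) p j / (2 * j%:R + 1).

Lemma trigH_pihalf J : trigH J (pi / 2) = pi / 2 - arcsin_sum J.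
Proof.
rewrite /trigH sin_pihalf; congr (_ - _).
by apply: eq_bigr => i _; rewrite expr1n mulr1.
Qed.

Lemma trigG_ge0 J x : 0 < x < pi / 2 -> 0 <= trigG J x.
Proof.
move=> /andP[x0 xp]; rewrite -(trigG0 J).
apply: (@le_of_derive_ge0 _ (fun x => w J * sin x ^+ (2 * J).+1)).
- exact: ltW.
- by move=> t; exact: is_derive_trigG.
- move=> t /andP[t0 tx]; rewrite mulr_ge0 ?(ltW (wbin_gt0 _ _))// exprn_ge0//.
  have tp : 0 < t < pi / 2 by rewrite t0 (lt_trans tx).
  by have /andP[] := sin_pihalf_bounds tp.
Qed.

Lemma arcsin_sum_le J : arcsin_sum J <= pi / 2.
Proof.
rewrite -subr_ge0 -trigH_pihalf -(trigH0 J).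
apply: (@le_of_derive_ge0 _ (trigG J)).
- exact: pihalf_ge0.
- by move=> t; exact: is_derive_trigH.
- by move=> t; exact: trigG_ge0.
Qed.

(** The constant 3 is not sharp but needs only crude estimates: up to pi / 4, 3 cos x is at least 3
    / sqrt 2 > 2 > pi / 2; beyond pi / 4, 3 sin > 1, so 3 cos x + x decreases to its value pi / 2 at
    pi / 2. *)
Lemma pihalf_sub_le x : 0 < x < pi / 2 -> pi / 2 - x <= 3 * cos x.
Proof.
move=> /andP[x0 xp]; have pi2 := pihalf_lt2 R.
have [/ltW xq|xq] := ltP x (pi / 4).
  have c : 0 <= cos x by apply: cos_ge0_pihalf; apply/andP; split; lra.
  have h : cos (pi / 4) <= cos x.
    rewrite leNgt ltr_cos ?in_itv/= -?leNgt//; apply/andP; split; lra.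
  have c2 : 1 / 2 <= cos (pi / 4) ^+ 2 :> R.
    have := cos_mulr2n (pi / 4 : R).
    rewrite (_ : pi / 4 *+ 2 = pi / 2) ?cos_pihalf; first lra.
    by rewrite -mulr_natr; field.
  have : 1 / 2 <= cos x ^+ 2.
    apply: (le_trans c2); rewrite ler_pXn2r// ?nnegrE//.
    by apply: cos_ge0_pihalf; apply/andP; split; lra.
  by rewrite expr2; nra.
have xp2 := ltW xp.
have h : sin (pi / 4) ^+ 2 = 1 / 2 :> R.
  have := cos_mulr2n (pi / 4 : R); rewrite cos2sin2.
  rewrite (_ : pi / 4 *+ 2 = pi / 2) ?cos_pihalf; first lra.
  by rewrite -mulr_natr; field.
have s0 : 0 <= sin (pi / 4) :> R by apply: sin_ge0_pi; apply/andP; split; lra.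
have := @le_of_derive_ge0 (fun t => - (3 * cos t + t))
  (fun t => 3 * sin t - 1) x (pi / 2) xp2.
rewrite cos_pihalf mulr0 add0r => H; suff : - (3 * cos x + x) <= - (pi / 2) by lra.
apply: H => [t|t /andP[tx tp]].
  by apply: trigger_derive; rewrite /GRing.scale/=; lra.
have : sin (pi / 4) < sin t.
  by rewrite ltr_sin ?in_itv/=; [lra|apply/andP; split; lra..].
nra.
Qed.

(** The remainder is the integral of [trigG J]. Integrating by parts, it is the integral of (pi / 2
    - t) w J sin t ^ (2 J + 1); bounding pi / 2 - t by 3 cos t makes this elementary, with value
    [c]. *)
Lemma arcsin_sum_ge J : pi / 2 - 3 * p J <= arcsin_sum J.
Proof.
have J0 := ler0n R J; have w0 := wbin_gt0 R J; have p0 := pbin_gt0 R J.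
pose c := 3 * w J / (2 * J%:R + 2).
have c0 : c <= 3 * p J by rewrite /c /wbin ler_pdivrMr; nra.
apply: (@le_trans _ _ (pi / 2 - c)); first lra.
suff : trigH J (pi / 2) <= c by rewrite trigH_pihalf; lra.
(* The integration by parts in differential form: this function vanishes at 0, equals [c] minus the
   remainder at pi / 2, and the two terms in [trigG J] cancel in its derivative. *)
have := @le_of_derive_ge0
  (fun t => c * sin t ^+ (2 * J).+2 - trigH J t - (pi / 2 - t) * trigG J t)
  (fun t => w J * sin t ^+ (2 * J).+1 * (3 * cos t - (pi / 2 - t)))
  0 (pi / 2) pihalf_ge0.
rewrite trigH0 trigG0 sin0 expr0n sin_pihalf expr1n subrr mul0r !mulr0 !subr0 mulr1.
rewrite subr_ge0; apply.
- move=> x; have d1 := is_derive_sinX (2 * J).+1 x; have d2 := is_derive_trigG J x.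
  have d3 := is_derive_trigH J x.
  apply: trigger_derive; rewrite /GRing.scale/= /c.
  rewrite -[(2 * J).+2%:R]natr1 -[(2 * J).+1%:R]natr1 natrM; field.
  by apply/eqP; lra.
- move=> x x01; have /andP[s0 _] := sin_pihalf_bounds x01.
  by rewrite mulr_ge0 ?subr_ge0 ?pihalf_sub_le// mulr_ge0 ?exprn_ge0// ltW.
Qed.

End Wallis.

(** * Asymptotics of the double sum *)

Section DoubleSum.
Variable R : realType.
Implicit Types (x : R) (j k n m : nat).
Local Notation p := (pbin R).
Local Notation w := (wbin R).

(* The infinite sum would be the Beta integral B(k + 1/2, 1/2) / 2, that is
   pi / 2 * p k. *)
Definition hilbert_sum n k : R := \sum_(j < n.+1) p j / (2 * k%:R + 2 * j%:R + 1).

Lemma hilbert_sum_ge0 n k : 0 <= hilbert_sum n k.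
Proof.
apply: sumr_ge0 => j _; have := ler0n R j; have := ler0n R k => *.
by rewrite divr_ge0 ?pbin_ge0//; lra.
Qed.

(* Summation by parts: with v j = 2 j p_j / (2 k + 2 j + 1), the left-hand side
   is the sum of the differences v (j + 1) - v j. *)
Lemma hilbert_sum_rec n k :
  (2 * k%:R + 1) * hilbert_sum n k - (2 * k%:R + 2) * hilbert_sum n k.+1 =
  w n / (2 * k%:R + 2 * n%:R + 3).
Proof.
have k0 := ler0n R k.
rewrite /hilbert_sum -[k.+1%:R]natr1; elim: n => [|n IH].
  rewrite !big_ord1 /wbin pbin0 /= !mulr0n; field.
  by apply/andP; split; apply/eqP; lra.
have n0 := ler0n R n.
rewrite [X in _ * X - _]big_ord_recr [X in _ - _ * X]big_ord_recr/=.
rewrite [X in X - _]mulrDr [X in _ - X]mulrDr opprD addrACA {}IH /wbin.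
rewrite -[n.+1%:R]natr1.
have := pbinS R n; set q := p n.+1 => <-.
by field; rewrite ?andbT; apply/andP; split; apply/eqP; lra.
Qed.

(** The bound pi / 2 * p k solves the homogeneous recurrence in k exactly, while the truncated sum
    only loses a nonnegative boundary term at each step. The case k = 0 is the arcsine series. *)
Lemma hilbert_sum_le n k : hilbert_sum n k <= pi / 2 * p k.
Proof.
elim: k => [|k IH].
  rewrite pbin0 mulr1 (le_trans _ (arcsin_sum_le R n))//.
  by apply: ler_sum => j _; rewrite mulr0 add0r.
have k0 := ler0n R k; have n0 := ler0n R n.
have v0 : 0 <= w n / (2 * k%:R + 2 * n%:R + 3).
  by rewrite divr_ge0 ?(ltW (wbin_gt0 _ _))//; lra.
have := hilbert_sum_rec n k; have := pbinS R k => e1 e2.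
have k2 : 0 < 2 * k%:R + 2 :> R by lra.
rewrite -(ler_pM2r k2) -[leRHS]mulrA e1.
have : (2 * k%:R + 1) * hilbert_sum n k <= (2 * k%:R + 1) * (pi / 2 * p k).
  by rewrite ler_wpM2l//; lra.
lra.
Qed.

(** Each step in k loses a boundary term of at most p n. The strengthened claim pays for it with a
    summand pi / 2 * p n * p k, which suffices since pi / 2 * p k * w k >= 1. As p k times the sum
    of the earlier p i is at most 1, the total loss is at most (3 + pi / 2) p n, below 5 p n. *)
Lemma hilbert_sum_ge n k : pi / 2 * p k - 5 * p n <= hilbert_sum n k.
Proof.
have pn0 := pbin_gt0 R n; have n0 := ler0n R n; have pi2 := pihalf_lt2 R.
have pi0 := pi_gt0 R.
suff : p k * (pi / 2 - 3 * p n) - pi / 2 * p n * (p k * \sum_(i < k) p i)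
    <= hilbert_sum n k.
  have pk0 := pbin_gt0 R k; have pk1 := pbin_le1 R k.
  have s1 : p k * \sum_(i < k) p i <= 1.
    apply: le_trans (pbin_wbin_le1 R k).
    by rewrite ler_wpM2l ?(ltW pk0)// -sum_pbin big_ord_recr/= lerDl pbin_ge0.
  have s0 : 0 <= p k * \sum_(i < k) p i.
    by rewrite mulr_ge0 ?(ltW pk0)// sumr_ge0// => i _; exact: pbin_ge0.
  have : pi / 2 * p n * (p k * \sum_(i < k) p i) <= 2 * p n.
    by rewrite mulrAC ler_wpM2r ?ltW//; nra.
  nra.
elim: k => [|k IH].
  rewrite big_ord0 pbin0 !mulr0 subr0 mul1r (le_trans (arcsin_sum_ge R n))//.
  by apply: ler_sum => j _; rewrite mulr0 add0r.
have k0 := ler0n R k.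
have v0 : w n / (2 * k%:R + 2 * n%:R + 3) <= p n.
  by rewrite ler_pdivrMr /wbin; nra.
have := hilbert_sum_rec n k; have := pbinS R k => e1 e2.
have k2 : 0 < 2 * k%:R + 2 :> R by lra.
rewrite -(ler_pM2r k2) big_ord_recr/=.
set s := \sum_(i < k) _ in IH *.
have -> : (p k.+1 * (pi / 2 - 3 * p n) - pi / 2 * p n * (p k.+1 * (s + p k))) *
  (2 * k%:R + 2) = p k.+1 * (2 * k%:R + 2) * (pi / 2 - 3 * p n - pi / 2 * p n * (s + p k)).
  by ring.
rewrite e1.
have k1 : 0 <= 2 * k%:R + 1 :> R by lra.
have := ler_wpM2l k1 IH.
have wl : 1 <= pi / 2 * (p k * w k).
  have := wallis_lower R k; rewrite ler_pdivrMr//; lra.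
have : p n <= pi / 2 * p n * (p k * w k) by nra.
rewrite /wbin; lra.
Qed.

Definition double_sum m n : R :=
  \sum_(k < m.+1) w (m - k) * p k *
    \sum_(j < n.+1) p (n - j) * p j / (2 * k%:R + 2 * j%:R + 1).

Definition sum_pbin2 m : R := \sum_(k < m.+1) p k ^+ 2.

Lemma sum_pbin2_le m : sum_pbin2 m <= m%:R + 1.
Proof.
have -> : m%:R + 1 = \sum_(k < m.+1) 1 :> R by rewrite sumr_const card_ord natr1.
apply: ler_sum => k _.
by rewrite exprn_ile1 ?pbin_ge0 ?pbin_le1.
Qed.

(* p (n - j) <= p n + j / n * p (n - j) *)
Lemma double_sum_inner_le n k : (0 < n)%N ->
  \sum_(j < n.+1) p (n - j) * p j / (2 * k%:R + 2 * j%:R + 1) <=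
  p n * hilbert_sum n k + (2 * n%:R)^-1.
Proof.
move=> n0; have n1 : 0 < n%:R :> R by rewrite ltr0n.
have -> : (2 * n%:R)^-1 = (2 * n%:R)^-1 * \sum_(j < n.+1) p (n - j) * p j.
  by rewrite sum_pbin_conv mulr1.
rewrite /hilbert_sum !mulr_sumr -big_split/=.
apply: ler_sum => j _.
have jn : (j <= n)%N by rewrite -ltnS.
have := mul_pbin_ndecr R (leq_subr j n); rewrite natrB// => h.
have j0 := ler0n R j; have k0 := ler0n R k.
have p0 := pbin_gt0 R j; have q0 := pbin_gt0 R (n - j).
set D := 2 * k%:R + 2 * j%:R + 1; have D0 : 0 < D by rewrite /D; lra.
rewrite ler_pdivrMr// -(ler_pM2l n1).
have -> : n%:R * ((p n * (p j / D) + (2 * n%:R)^-1 * (p (n - j) * p j)) * D) =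
  n%:R * p n * p j + p (n - j) * p j * (D / 2).
  by field; rewrite !gt_eqF.
have := ler_wpM2r (ltW p0) h.
have : p (n - j) * p j * j%:R <= p (n - j) * p j * (D / 2).
  rewrite ler_wpM2l ?mulr_ge0 ?(ltW p0) ?(ltW q0)// ler_pdivlMr// /D; lra.
lra.
Qed.

Lemma double_sum_le m n : (0 < m)%N -> (m <= n)%N ->
  double_sum m n <= sum_pbin2 m + 3.
Proof.
move=> m0 mn; have m1 : 1 <= m%:R :> R by rewrite ler1n.
have w0 := wbin_gt0 R m; have pn0 := pbin_gt0 R n; have pm0 := pbin_gt0 R m.
have pi0 := pi_gt0 R.
have mn' : m%:R <= n%:R :> R by rewrite ler_nat.
have n0 : 0 < (2 * n%:R)^-1 :> R by rewrite invr_gt0; lra.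
have A0 : 0 <= sum_pbin2 m by apply: sumr_ge0 => k _; exact: sqr_ge0.
(* Here w (m - k) is replaced by w m and the inner sum by its bound; the errors 1 / (2 n) add up,
   through the sum of the p k, to w m ^ 2 / (2 n). *)
apply: (@le_trans _ _ (pi / 2 * w m * p n * sum_pbin2 m + w m * (w m / (2 * n%:R)))).
  have -> : w m * (w m / (2 * n%:R)) = \sum_(k < m.+1) w m * (p k / (2 * n%:R)).
    by rewrite -mulr_sumr -mulr_suml sum_pbin.
  rewrite /sum_pbin2 mulr_sumr -big_split/=.
  apply: ler_sum => k _.
  have pk0 := pbin_gt0 R k.
  apply: (@le_trans _ _ (w m * p k * (p n * (pi / 2 * p k) + (2 * n%:R)^-1))); last lra.
  apply: ler_pM.
  - by rewrite mulr_ge0 ?ltW// wbin_gt0.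
  - apply: sumr_ge0 => j _; have := ler0n R j; have := ler0n R k => *.
    by rewrite divr_ge0 ?mulr_ge0 ?pbin_ge0//; lra.
  - by rewrite ler_wpM2r ?(ltW pk0)// wbin_ndecr// leq_subr.
  - apply: (le_trans (double_sum_inner_le k (leq_trans m0 mn))).
    by rewrite lerD2r ler_wpM2l ?(ltW pn0)// hilbert_sum_le.
(* Since p m * w m <= 1, w m ^ 2 <= 2 m + 1 <= 3 n, so this error is at most 3 / 2. The coefficient
   pi / 2 * w m * p m exceeds 1 by at most 1 / (2 m), which costs at most (m + 1) / (2 m) <= 1
   against the sum of squares. *)
have w1 := pbin_wbin_le1 R m.
have wu : pi / 2 * (w m * p m) * (2 * m%:R) <= 2 * m%:R + 1.
  have := wallis_upper R m; rewrite ler_pdivlMr// /wbin expr2.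
  by nra.
have h1 : w m * (w m / (2 * n%:R)) <= 3 / 2.
  rewrite mulrA ler_pdivrMr; last lra.
  by rewrite {2}/wbin; nra.
have h2 : pi / 2 * w m * p n * sum_pbin2 m <= pi / 2 * (w m * p m) * sum_pbin2 m.
  rewrite ler_wpM2r// -mulrA ler_wpM2l ?ler_wpM2l ?pbin_nincr ?ltW//.
  by rewrite divr_gt0.
have h3 : pi / 2 * (w m * p m) * sum_pbin2 m <= sum_pbin2 m + 1.
  have m2 : 0 < 2 * m%:R :> R by lra.
  rewrite -(ler_pM2r m2) mulrAC.
  have := ler_wpM2r A0 wu; have := sum_pbin2_le m; lra.
lra.
Qed.

Lemma double_sum_ge m n : (0 < m)%N -> (m <= n <= m.+1)%N ->
  sum_pbin2 m - 7 <= double_sum m n.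
Proof.
move=> m0 /andP[mn nm]; have m1 : 1 <= m%:R :> R by rewrite ler1n.
have w0 := wbin_gt0 R m; have pn0 := pbin_gt0 R n; have pm0 := pbin_gt0 R m.
have pi0 := pi_gt0 R.
have mn' : m%:R <= n%:R :> R by rewrite ler_nat.
have A0 : 0 <= sum_pbin2 m by apply: sumr_ge0 => k _; exact: sqr_ge0.
have pw : p n * w m <= 1.
  by apply: le_trans (pbin_wbin_le1 R m); rewrite ler_wpM2r ?(ltW w0) ?pbin_nincr.
(* Of the 6, one unit covers the m + 1 terms 1 / (2 m), and five cover 5 * p n * w m. One more unit
   is lost when pi / 2 * w m * p n is replaced by 1; this uses n <= m + 1, through p n >= p (m + 1).
   Hence the 7. *)
apply: (@le_trans _ _ (w m * p n * (pi / 2 * sum_pbin2 m - 6))).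
  have h : (2 * m%:R + 1) / (2 * m%:R + 2) <= pi / 2 * (w m * p n).
    apply: (@le_trans _ _ (pi / 2 * (w m * p m.+1))); last first.
      by rewrite !ler_wpM2l ?pbin_nincr ?(ltW w0)// divr_ge0 ?ltW.
    rewrite pbinSE.
    have := wallis_lower R m; rewrite ler_pdivrMr// => h.
    set X := _ / _; have X0 : 0 <= X by rewrite divr_ge0//; lra.
    have -> : pi / 2 * (w m * (X * p m)) = X * (pi / 2 * (p m * w m)) by ring.
    by rewrite ler_peMr//; lra.
  have := ler_wpM2r A0 h.
  have : sum_pbin2 m - 1 <= (2 * m%:R + 1) / (2 * m%:R + 2) * sum_pbin2 m.
    have -> : (2 * m%:R + 1) / (2 * m%:R + 2) * sum_pbin2 m =
      sum_pbin2 m - sum_pbin2 m / (2 * m%:R + 2).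
      by field; apply/eqP; lra.
    rewrite lerD2l lerN2 ler_pdivrMr; last lra.
    have := sum_pbin2_le m; lra.
  nra.
apply: (@le_trans _ _ (\sum_(k < m.+1) w m * p n *
   (pi / 2 * p k ^+ 2 - (2 * m%:R)^-1 - 5 * p n * p k))).
  rewrite -mulr_sumr ler_wpM2l ?mulr_ge0 ?(ltW w0) ?(ltW pn0)//.
  rewrite !big_split/= -mulr_sumr sumrN sumrN -mulr_sumr sum_pbin.
  rewrite -[\sum_(i < _) p i ^+ 2]/(sum_pbin2 m).
  have -> : \sum_(i < m.+1) (2 * m%:R)^-1 = (m%:R + 1) / (2 * m%:R) :> R.
    by rewrite sumr_const card_ord -[LHS]mulr_natl -[m.+1%:R]natr1.
  have : (m%:R + 1) / (2 * m%:R) <= 1 :> R by rewrite ler_pdivrMr; lra.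
  lra.
apply: ler_sum => k _.
have km : (k <= m)%N by rewrite -ltnS.
have k0 := ler0n R k; have pk0 := pbin_gt0 R k.
have H0 := hilbert_sum_ge0 n k.
apply: (@le_trans _ _ (w (m - k) * p k * (p n * hilbert_sum n k))); last first.
  rewrite ler_wpM2l ?mulr_ge0 ?(ltW pk0) ?(ltW (wbin_gt0 _ _))//.
  rewrite mulr_sumr; apply: ler_sum => j _.
  have j0 := ler0n R j.
  rewrite mulrA ler_wpM2r ?invr_ge0 ?ler_wpM2r ?pbin_ge0//.
  by rewrite pbin_nincr// leq_subr.
have wk : (m%:R - k%:R) / m%:R * w m <= w (m - k).
  have := wbin_div_nincr R (leq_subr k m); rewrite natrB// => h.
  by rewrite mulrAC ler_pdivrMr; lra.
apply: (@le_trans _ _ ((m%:R - k%:R) / m%:R * w m * p k * (p n * hilbert_sum n k))); last first.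
  by rewrite ler_wpM2r ?mulr_ge0 ?(ltW pn0)// ler_wpM2r ?(ltW pk0).
rewrite -subr_ge0.
have -> : (m%:R - k%:R) / m%:R * w m * p k * (p n * hilbert_sum n k) -
   w m * p n * (pi / 2 * p k ^+ 2 - (2 * m%:R)^-1 - 5 * p n * p k) =
   w m * p n * ((m%:R - k%:R) / m%:R * p k * hilbert_sum n k -
     (pi / 2 * p k ^+ 2 - (2 * m%:R)^-1 - 5 * p n * p k)) by ring.
rewrite mulr_ge0 ?mulr_ge0 ?(ltW w0) ?(ltW pn0)// subr_ge0.
set c : R := (m%:R - k%:R) / m%:R.
have c0 : 0 <= c by rewrite divr_ge0 ?subr_ge0 ?ler_nat//; lra.
have c1 : c <= 1 by rewrite ler_pdivrMr; lra.
apply: (@le_trans _ _ (c * p k * (pi / 2 * p k - 5 * p n))); last first.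
  exact: ler_wpM2l (mulr_ge0 c0 (ltW pk0)) _ _ (hilbert_sum_ge n k).
(* The cost of the factor 1 - k / m: by Wallis, pi * k * p k ^ 2 <= 1, so each k contributes at most
   1 / (2 m) in spite of the growing weight k / m. *)
have : (1 - c) * (pi / 2 * p k ^+ 2) <= (2 * m%:R)^-1.
  have -> : 1 - c = k%:R / m%:R by rewrite /c; field; apply/eqP; lra.
  have := wallis_upper R k; rewrite ler_pdivlMr// => h.
  rewrite -[leRHS]mul1r ler_pdivlMr; last lra.
  have -> : k%:R / m%:R * (pi / 2 * p k ^+ 2) * (2 * m%:R) = pi * k%:R * p k ^+ 2.
    by field; apply/eqP; lra.
  lra.
have : c * (5 * p n * p k) <= 5 * p n * p k.
  by rewrite ler_piMl// mulr_ge0 ?(ltW pk0)//; lra.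
lra.
Qed.

Lemma ln_succ_le k : (0 < k)%N -> ln k.+1%:R - ln k%:R <= k%:R^-1 :> R.
Proof.
move=> k0; have k1 : 0 < k%:R :> R by rewrite ltr0n.
rewrite -ln_div ?posrE ?ltr0n//.
have -> : k.+1%:R / k%:R = 1 + k%:R^-1 :> R.
  by rewrite -natr1 mulrDl mulfV ?gt_eqF// mul1r.
by apply: le_ln1Dx; rewrite (lt_trans _ (_ : 0 < _)) ?invr_gt0//; lra.
Qed.

Lemma ln_succ_ge k : (0 < k)%N -> k.+1%:R^-1 <= ln k.+1%:R - ln k%:R :> R.
Proof.
move=> k0; have k1 : 0 < k%:R :> R by rewrite ltr0n.
rewrite -lerN2 opprB -ln_div ?posrE ?ltr0n//.
have -> : k%:R / k.+1%:R = 1 - k.+1%:R^-1 :> R.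
  by rewrite -natr1; field; apply/eqP; lra.
apply: le_ln1Dx; rewrite ltrN2 invf_lt1 ?ltr0n// ltr1n; lia.
Qed.

(** Wallis' lower bound gives pi * p (m + 1) ^ 2 >= 2 / (2 m + 3) >= 1 / (m + 2), which dominates
    the increment of the logarithm from m + 2 to m + 3. *)
Lemma sum_pbin2_ge_ln m : ln m.+2%:R / pi <= sum_pbin2 m.
Proof.
have pi0 := pi_gt0 R; have pi2 := pi_ge2 R.
rewrite ler_pdivrMr//; elim: m => [|m IH].
  rewrite /sum_pbin2 big_ord1 pbin0 expr1n mul1r.
  by rewrite (le_trans _ pi2)// ltW// ln_sublinear.
rewrite /sum_pbin2 big_ord_recr/= -/(sum_pbin2 m) mulrDl.
have := @ln_succ_le m.+2 isT.
have : m.+2%:R^-1 <= p m.+1 ^+ 2 * pi.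
  have := wallis_lower R m.+1; rewrite ler_pdivrMr// /wbin => h.
  rewrite -[m.+2%:R]natr1 -div1r; set y := m.+1%:R in h *.
  have y1 : 1 <= y by rewrite ler1n.
  rewrite ler_pdivrMr; last lra.
  have : p m.+1 * p m.+1 * pi >= 0 by rewrite !mulr_ge0 ?pbin_ge0 ?(ltW pi0).
  rewrite expr2; nra.
by move=> a b; apply: le_trans (lerD IH a); rewrite -lerBlDl.
Qed.

(** Wallis' upper bound gives pi * p k ^ 2 <= 1 / k <= ln k - ln (k - 1) for k >= 2; the constant 2
    covers the terms k = 0 and k = 1. *)
Lemma sum_pbin2_le_ln m : sum_pbin2 m.+1 <= 2 + ln m.+1%:R / pi.
Proof.
have pi0 := pi_gt0 R; have pi2 := pi_ge2 R.
have key k : p k.+1 ^+ 2 * pi <= k.+1%:R^-1.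
  have := wallis_upper R k.+1; rewrite ler_pdivlMr// => h.
  rewrite -[leRHS]div1r ler_pdivlMr ?ltr0n//; lra.
elim: m => [|m IH].
  rewrite ln1 mul0r addr0 /sum_pbin2 !big_ord_recl big_ord0/= addr0 pbin0 expr1n.
  have := pbin_le1 R 1; have := pbin_ge0 R 1; rewrite /bump/= expr2; nra.
rewrite /sum_pbin2 big_ord_recr/= -/(sum_pbin2 m.+1).
apply: (le_trans (lerD IH (lexx _))); rewrite -addrA lerD2l.
rewrite -lerBrDl -mulrBl ler_pdivlMr//.
exact: le_trans (key _) (ln_succ_ge _).
Qed.

Lemma double_sum_ln m n : (0 < m)%N -> (m <= n <= m.+1)%N ->
  `|double_sum m n - ln m%:R / pi| <= 9.
Proof.
case: m => // m _ mn; have pi0 := pi_gt0 R; have /andP[mn1 _] := mn.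
have := double_sum_le (ltn0Sn m) mn1.
have := double_sum_ge (ltn0Sn m) mn.
have := sum_pbin2_le_ln m; have := sum_pbin2_ge_ln m.+1.
have : ln m.+1%:R / pi <= ln m.+3%:R / pi :> R.
  by rewrite ler_pM2r ?invr_gt0// ler_ln ?posrE ?ltr0n// ler_nat; lia.
by move=> *; rewrite ler_norml; apply/andP; split; lra.
Qed.

Lemma double_sum_asymptotics (r : nat -> R) :
  (forall m, r (2 * m + 1)%N = double_sum m m) ->
  (forall m, r (2 * m + 2)%N = double_sum m m.+1) ->
  (fun N => r N / (1 / pi * ln N%:R)) @ \oo --> (1 : R).
Proof.
move=> rodd reven; have pi0 := pi_gt0 R; have pi2 := pi_ge2 R.
(* The 9 of the double sum, plus 2 for passing from ln m to ln N: N <= 4 m bounds the difference of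
   the logarithms by 4, and it is divided by pi >= 2. *)
have bnd N : (2 < N)%N -> `|r N - ln N%:R / pi| <= 11.
  move=> N2; pose m := (N.-1)./2.
  have m0 : (0 < m)%N by rewrite /m; lia.
  have [n mn rN] : exists2 n, (m <= n <= m.+1)%N & r N = double_sum m n.
    have [oN|eN] := boolP (odd N).
      by exists m; [lia|rewrite -rodd; congr r; rewrite /m; lia].
    by exists m.+1; [lia|rewrite -reven; congr r; rewrite /m; lia].
  have := double_sum_ln m0 mn; rewrite -rN ler_norml => /andP[h1 h2].
  have m1 : 0 < m%:R :> R by rewrite ltr0n.
  have N1 : 0 < N%:R :> R by rewrite ltr0n; lia.
  have h3 : ln m%:R <= ln N%:R :> R.
    by rewrite ler_ln ?posrE// ler_nat /m; lia.
  have h4 : ln N%:R <= 4 + ln m%:R :> R.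
    rewrite -lerBlDr -ln_div ?posrE//.
    apply: (@le_trans _ _ (N%:R / m%:R)); first by rewrite ltW// ln_sublinear// divr_gt0.
    by rewrite ler_pdivrMr// -natrM ler_nat /m; lia.
  have h5 : ln m%:R / pi <= ln N%:R / pi :> R by rewrite ler_pM2r ?invr_gt0.
  have h6 : ln N%:R / pi <= 2 + ln m%:R / pi :> R.
    by rewrite ler_pdivrMr// mulrDl divfK ?gt_eqF//; lra.
  by rewrite ler_norml; apply/andP; split; lra.
apply/cvgrPdist_le => e e0.
near=> N.
have N2 : (2 < N)%N by near: N; exact: nbhs_infty_gt.
have lN : 11 * pi / e <= ln N%:R.
  rewrite -[leLHS](expRK) ler_ln ?posrE ?expR_gt0 ?ltr0n//; last by lia.
  by near: N; exact: nbhs_infty_ger.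
have l0 : 0 < ln N%:R :> R by rewrite ln_gt0// ltr1n; lia.
rewrite distrC.
have alg (a b c : R) : b != 0 -> c != 0 ->
    a / (1 / b * c) - 1 = (a - c / b) / (c / b).
  by move=> b0 c0; field; rewrite b0.
rewrite alg ?gt_eqF//.
rewrite normrM [`|_^-1|]ger0_norm; last by rewrite invr_ge0 divr_ge0 ?ltW.
rewrite ler_pdivrMr; last by rewrite divr_gt0.
apply: (le_trans (bnd _ N2)).
by move: lN; rewrite ler_pdivrMr// mulrA ler_pdivlMr// [e * _]mulrC.
Unshelve. all: by end_near.
Qed.

End DoubleSum.

(** * The Schur-Cohn recursion *)

Section SchurCohn.
Variable C : numClosedFieldType.
Implicit Types (p : {poly C}) (a z : C).

(** A Blaschke factor has modulus at least 1 outside the disk: the difference of the squared moduli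
    is (|z|^2 - 1) (1 - |a|^2). *)
Lemma norm_blaschke_le a z : `|a| <= 1 -> 1 <= `|z| ->
  `|1 - z^* * a| <= `|z - a|.
Proof.
move=> a1 z1; rewrite -(@ler_pXn2r _ 2) ?nnegrE ?normr_ge0//.
rewrite !normCK -subr_ge0 !rmorphB !rmorphM/= rmorph1 conjCK.
have -> : (z - a) * (z^* - a^*) - (1 - z^* * a) * (1 - z * a^*) =
  (z * z^* - 1) * (1 - a * a^*) by ring.
by rewrite -!normCK mulr_ge0// subr_ge0 ?expr_ge1 ?exprn_ile1.
Qed.

Lemma poly_prod_roots p : exists2 r : seq C,
  (forall z, p.[z] = lead_coef p * \prod_(a <- r) (z - a)) &
  size p = ((p != 0)%R + size r)%N /\ (p != 0 -> forall a, a \in r -> root p a).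
Proof.
have [r pr] := closed_field_poly_normal p.
have [p0|p0] := eqVneq p 0.
  exists [::]; last by rewrite p0 size_poly0.
  by move=> z; rewrite p0 horner0 lead_coef0 mul0r.
have l0 : lead_coef p != 0 by rewrite lead_coef_eq0.
exists r.
  move=> z; rewrite {1}pr hornerZ horner_prod; congr (_ * _).
  by apply: eq_bigr => a _; rewrite hornerXsubC.
split; first by rewrite {1}pr size_scale// size_prod_XsubC.
by move=> _ a ar; rewrite pr rootZ// root_prod_XsubC.
Qed.

(** As p is real, z may be replaced by its conjugate on the left; each factor of the reciprocal
    polynomial then becomes 1 - conj z * a, a Blaschke numerator. This domination outside the disk
    replaces Rouché's theorem in the Schur-Cohn recursion. *)
Lemma norm_horner_recip_le p z : map_poly Num.conj p = p ->
  (forall a, root p a -> `|a| <= 1) -> 1 <= `|z| ->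
  `|z ^+ (size p).-1 * p.[z^-1]| <= `|p.[z]|.
Proof.
move=> pconj proots z1.
have [r pr [sr rr]] := poly_prod_roots p.
have [p0|p0] := eqVneq p 0; first by rewrite p0 !horner0 mulr0.
have z0 : z != 0 by rewrite -normr_gt0 (lt_le_trans ltr01).
have -> : `|z ^+ (size p).-1 * p.[z^-1]| = `|z^* ^+ (size p).-1 * p.[(z^*)^-1]|.
  by rewrite -norm_conjC rmorphM rmorphXn/= -horner_map/= pconj fmorphV.
rewrite sr p0 add1n/= !pr !normrM mulrCA ler_wpM2l//.
have -> : `|z^* ^+ size r| = \prod_(a <- r) `|z^*|.
  by rewrite normrX big_const_seq count_predT iter_mulr mulr1.
rewrite !normr_prod -big_split/=.
rewrite big_seq_cond [leRHS]big_seq_cond; apply: ler_prod => a.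
rewrite andbT => ar; rewrite mulr_ge0//= -normrM mulrBr mulfV ?conjC_eq0//.
by rewrite norm_blaschke_le// proots// rr.
Qed.

(** Each factor z - a has modulus at least |z| - 1. Unlike the mere absence of zeros, this is a
    closed condition at each z, so it can be tested at rational points. *)
Lemma norm_horner_ge p z : p \is monic -> (forall a, root p a -> `|a| <= 1) ->
  1 <= `|z| -> (`|z| - 1) ^+ (size p).-1 <= `|p.[z]|.
Proof.
move=> pm proots z1.
have [r pr [sr rr]] := poly_prod_roots p.
have p0 := monic_neq0 pm.
rewrite sr p0 add1n/= pr (monicP pm) mul1r normr_prod.
have -> : (`|z| - 1) ^+ size r = \prod_(a <- r) (`|z| - 1).
  by rewrite big_const_seq count_predT iter_mulr mulr1.
rewrite big_seq_cond [leRHS]big_seq_cond; apply: ler_prod => a.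
rewrite andbT => ar; rewrite subr_ge0 z1/=.
apply: le_trans (lerB_dist _ _); rewrite lerD2l lerN2.
by rewrite proots// rr.
Qed.

Lemma norm_horner0_le1 p : p \is monic -> (forall a, root p a -> `|a| <= 1) ->
  `|p.[0]| <= 1.
Proof.
move=> pm proots; have [r pr [sr rr]] := poly_prod_roots p.
rewrite pr (monicP pm) mul1r normr_prod.
rewrite big_seq_cond; apply: prodr_ile1 => a.
by rewrite andbT => ar; rewrite normr_ge0 sub0r normrN proots// rr// monic_neq0.
Qed.

End SchurCohn.

(** * Monic polynomials as coefficient tuples: Horner's scheme and the Schur-Cohn map *)

Section MonicPoly.
Variable R : realType.
Implicit Types (x c k : R) (n : nat).

Definition disk_roots (p : {poly R}) := forall z : R[i],
  root (map_poly (real_complex R) p) z -> `|z| <= 1.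

Lemma monic_poly0 (t : 0.-tuple R) : monic_poly t = 1.
Proof. by rewrite /monic_poly big_ord0 addr0 expr0. Qed.

Lemma tnth_rcons_l n T (t : n.-tuple T) (c : T) (i : 'I_n) (j : 'I_n.+1) :
  i = j :> nat -> tnth [tuple of rcons t c] j = tnth t i.
Proof.
by move=> ij; rewrite !(tnth_nth c)/= nth_rcons size_tuple -ij ltn_ord.
Qed.

Lemma tnth_rcons_r n T (t : n.-tuple T) (c : T) (j : 'I_n.+1) :
  j = n :> nat -> tnth [tuple of rcons t c] j = c.
Proof. by move=> jn; rewrite (tnth_nth c)/= nth_rcons size_tuple jn ltnn eqxx. Qed.

Lemma monic_poly_rcons n (t : n.-tuple R) c :
  monic_poly [tuple of rcons t c] = monic_poly t * 'X + c%:P.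
Proof.
rewrite /monic_poly big_ord_recr/= (@tnth_rcons_r n _ t c ord_max)// subnn expr0.
rewrite alg_polyC addrA; congr (_ + _).
rewrite mulrDl -exprSr; congr (_ + _); rewrite mulr_suml; apply: eq_bigr => i _.
rewrite (@tnth_rcons_l n _ t c i)// -scalerAl -exprSr.
by congr (_ *: 'X^_); have := ltn_ord i; lia.
Qed.

Lemma tuple_rconsP n T (t : n.+1.-tuple T) :
  exists (t' : n.-tuple T) (c : T), t = [tuple of rcons t' c].
Proof.
case: t => s; case/lastP: s => // s c sc.
have ss : size s == n by move: sc; rewrite size_rcons.
by exists (Tuple ss), c; apply/val_inj.
Qed.

Lemma monic_poly_size n (t : n.-tuple R) :
  size (monic_poly t) = n.+1 /\ monic_poly t \is monic.
Proof.
elim: n t => [|n IH] t; first by rewrite monic_poly0 size_poly1 monic1.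
have [t' [c ->]] := tuple_rconsP t; rewrite monic_poly_rcons.
have [st mt] := IH t'.
have st0 : monic_poly t' != 0 := monic_neq0 mt.
have h : (size (c%:P : {poly R}) < size (monic_poly t' * 'X)%R)%N.
  by rewrite size_mulX// st (leq_ltn_trans (size_polyC_leq1 _)).
split; first by rewrite size_polyDl// size_mulX// st.
by rewrite monicE lead_coefDl// lead_coefMX; exact: mt.
Qed.

Lemma horner_monic_poly_rcons n (t : n.-tuple R) c x :
  (monic_poly [tuple of rcons t c]).[x] = (monic_poly t).[x] * x + c.
Proof. by rewrite monic_poly_rcons !hornerE. Qed.

Lemma monic_poly_foldl n (t : n.-tuple R) x :
  (monic_poly t).[x] = foldl (fun q a => a + x * q) 1 t.
Proof.
elim: n t => [|n IH] t; first by rewrite monic_poly0 hornerE tuple0.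
have [t' [c ->]] := tuple_rconsP t.
by rewrite horner_monic_poly_rcons /= foldl_rcons -IH addrC mulrC.
Qed.

(* For q = 1 this is Horner's scheme: the quotient of 'X P - x P(x) by 'X - x. *)
Definition synthetic_div n x q (t : n.-tuple R) : n.-tuple R :=
  [tuple of scanl (fun q a => a + x * q) q t].

Lemma synthetic_div_rcons n x (t : n.-tuple R) c :
  synthetic_div x 1 [tuple of rcons t c] =
  [tuple of rcons (synthetic_div x 1 t) (monic_poly [tuple of rcons t c]).[x]].
Proof. by apply/val_inj; rewrite /= scanl_rcons monic_poly_foldl. Qed.

Lemma synthetic_divP n x (t : n.-tuple R) :
  monic_poly t * 'X - (x * (monic_poly t).[x])%:P =
  ('X - x%:P) * monic_poly (synthetic_div x 1 t).
Proof.
elim: n t => [|n IH] t; first by rewrite !monic_poly0 hornerC !mulr1 mul1r.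
have [t' [c ->]] := tuple_rconsP t.
rewrite synthetic_div_rcons [in RHS]monic_poly_rcons mulrDr [in RHS]mulrA -IH.
rewrite horner_monic_poly_rcons monic_poly_rcons.
by rewrite !(polyCM, polyCD); ring.
Qed.

Lemma monic_poly_rcons_root n x (t : n.-tuple R) :
  monic_poly [tuple of rcons t (- (x * (monic_poly t).[x]))] =
  ('X - x%:P) * monic_poly (synthetic_div x 1 t).
Proof. by rewrite monic_poly_rcons polyCN synthetic_divP. Qed.

Lemma disk_rootsM (p q : {poly R}) :
  disk_roots (p * q) <-> disk_roots p /\ disk_roots q.
Proof.
split=> [h|[hp hq] z]; last by rewrite rmorphM rootM => /orP[/hp|/hq].
by split=> z rz; apply: h; rewrite rmorphM rootM rz ?orbT.
Qed.

Lemma norm_real_complex x : `|real_complex R x| = real_complex R `|x|.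
Proof. by rewrite normc_def/= expr0n addr0 sqrtr_sqr. Qed.

Lemma disk_roots_XsubC x : disk_roots ('X - x%:P) <-> `|x| <= 1.
Proof.
rewrite /disk_roots rmorphB/= map_polyX map_polyC/=.
split=> [/(_ (real_complex R x))|x1 z].
  by rewrite root_XsubC eqxx => /(_ isT); rewrite norm_real_complex lecE/= eqxx.
by rewrite root_XsubC => /eqP->; rewrite norm_real_complex lecE/= eqxx.
Qed.

Lemma disk_roots_real_root n (t : n.-tuple R) (x : R) :
  disk_roots (monic_poly t) -> root (monic_poly t) x -> `|x| <= 1.
Proof.
move=> h rx; suff : `|real_complex R x| <= 1.
  by rewrite norm_real_complex lecE/= eqxx.
by apply: h; rewrite fmorph_root.
Qed.

(* The coefficients of 'X P + k 'X^n P(1/'X), except its leading 1 and its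
   constant term k. *)
Definition schur_map n k (t : n.-tuple R) : n.-tuple R :=
  [tuple of map (fun u => u.1 + k * u.2) (zip t (rev t))].

Lemma tnth_schur_map n k (t : n.-tuple R) i :
  tnth (schur_map k t) i = tnth t i + k * tnth t (rev_ord i).
Proof.
rewrite tnth_map !(tnth_nth 0)/= nth_zip ?size_rev//= nth_rev size_tuple //.
Qed.

Lemma horner_map_monic n (t : n.-tuple R) (z : R[i]) :
  (map_poly (real_complex R) (monic_poly t)).[z] =
  z ^+ n + \sum_(i < n) real_complex R (tnth t i) * z ^+ (n - i.+1).
Proof.
rewrite /monic_poly rmorphD rmorph_sum/= map_polyXn hornerD horner_sum hornerXn.
by congr (_ + _); apply: eq_bigr => i _; rewrite map_polyZ/= map_polyXn hornerZ hornerXn.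
Qed.

Lemma horner_schur n k (t : n.-tuple R) (z : R[i]) : z != 0 ->
  let B := map_poly (real_complex R) (monic_poly t) in
  (map_poly (real_complex R)
    (monic_poly [tuple of rcons (schur_map k t) k])).[z] =
  z * B.[z] + real_complex R k * (z ^+ n * B.[z^-1]).
Proof.
move=> z0 B; rewrite monic_poly_rcons rmorphD rmorphM/= map_polyX map_polyC.
rewrite hornerD hornerMX hornerC /B !horner_map_monic.
have -> : z ^+ n * (z^-1 ^+ n +
    \sum_(i < n) real_complex R (tnth t i) * z^-1 ^+ (n - i.+1)) =
    1 + \sum_(i < n) real_complex R (tnth t (rev_ord i)) * z ^+ (n - i).
  rewrite mulrDr exprVn mulfV ?expf_neq0//; congr (_ + _).
  rewrite (reindex_inj rev_ord_inj)/= mulr_sumr; apply: eq_bigr => i _.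
  rewrite mulrCA; congr (_ * _).
  have ni : (i < n)%N := ltn_ord i.
  have -> : (n - (n - i.+1).+1 = i)%N by lia.
  rewrite -{1}(subnK (ltnW ni)) exprD -mulrA -exprMn mulfV// expr1n mulr1.
  by [].
under eq_bigr do rewrite tnth_schur_map rmorphD rmorphM mulrDl.
rewrite big_split/=.
have -> : \sum_(i < n) real_complex R (tnth t (rev_ord i)) * z ^+ (n - i) =
    z * \sum_(i < n) real_complex R (tnth t (rev_ord i)) * z ^+ (n - i.+1).
  rewrite mulr_sumr; apply: eq_bigr => i _.
  by rewrite mulrCA -exprS subnSK.
have -> : \sum_(i < n) real_complex R k * real_complex R (tnth t (rev_ord i)) *
    z ^+ (n - i.+1) = real_complex R k *
    \sum_(i < n) real_complex R (tnth t (rev_ord i)) * z ^+ (n - i.+1).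
  by rewrite mulr_sumr; apply: eq_bigr => i _; rewrite mulrA.
ring.
Qed.

Lemma map_conj_real_poly (p : {poly R}) :
  map_poly Num.conj (map_poly (real_complex R) p) = map_poly (real_complex R) p.
Proof.
rewrite -map_poly_comp; apply: eq_map_poly => x /=.
exact: (conjc_real x).
Qed.

Lemma disk_roots_schur n k (t : n.-tuple R) : `|k| < 1 ->
  disk_roots (monic_poly [tuple of rcons (schur_map k t) k]) <->
  disk_roots (monic_poly t).
Proof.
move=> k1.
have kC : `|real_complex R k| < 1 by rewrite norm_real_complex ltcE/= eqxx.
pose P := map_poly (real_complex R) (monic_poly [tuple of rcons (schur_map k t) k]).
pose B := map_poly (real_complex R) (monic_poly t).
have sP : (size P).-1 = n.+1 by rewrite size_map_poly (monic_poly_size _).1.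
have sB : (size B).-1 = n by rewrite size_map_poly (monic_poly_size _).1.
have nz (z : R[i]) : 1 <= `|z| -> z != 0.
  by move=> z1; rewrite -normr_gt0 (lt_le_trans ltr01).
split=> h z rz; rewrite real_leNgt ?normr_real ?real1//; apply/negP => z1;
  have z0 := nz _ (ltW z1).
(* At a root z of B, P(z) equals k times z^(n+1) P(1/z), whose modulus is at most |k| |P(z)|. Since
   |k| < 1 this forces P(z) = 0, although P has no root outside the disk. *)
- have Bz : B.[z] = 0 by apply/eqP.
  have := @horner_schur n k t z z0; rewrite /= -/B -/P Bz mulr0 add0r => Pz.
  have := @horner_schur n k t z^-1 _; rewrite /= -/B -/P invrK Bz mulr0.
  rewrite mulr0 addr0 invr_eq0 => /(_ z0) Pzi.
  have := norm_horner_recip_le (map_conj_real_poly _) h (ltW z1).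
  rewrite -/P sP Pzi exprS mulrAC mulrA mulfV// mul1r => le1.
  have : `|P.[z]| <= `|real_complex R k| * `|P.[z]|.
    by rewrite {1}Pz normrM ler_wpM2l// mulrC.
  have [Pz0|Pz0] := eqVneq P.[z] 0.
    by move=> _; have := h z; rewrite /root -/P Pz0 eqxx => /(_ isT); rewrite lt_geF.
  by rewrite ler_pMl ?normr_gt0// lt_geF.
(* At a root z of P, |z B(z)| = |k z^n B(1/z)| <= |B(z)|. Since |z| > 1 this forces B(z) = 0. *)
- have Pz : P.[z] = 0 by apply/eqP.
  have := @horner_schur n k t z z0; rewrite /= -/B -/P Pz => /esym/eqP.
  rewrite addrC addr_eq0 => /eqP/(congr1 Num.norm).
  rewrite normrN !normrM => e.
  have := norm_horner_recip_le (map_conj_real_poly _) h (ltW z1).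
  rewrite -/B sB normrM => le1.
  have [Bz0|Bz0] := eqVneq B.[z] 0.
    by have := h z; rewrite /root -/B Bz0 eqxx => /(_ isT); rewrite lt_geF.
  have : `|z| * `|B.[z]| <= `|B.[z]|.
    by rewrite -e; apply: le_trans le1; rewrite ler_piMl ?mulr_ge0// ltW.
  by rewrite ger_pMl ?normr_gt0// lt_geF.
Qed.

Lemma disk_roots_last n (t : n.-tuple R) c :
  disk_roots (monic_poly [tuple of rcons t c]) -> `|c| <= 1.
Proof.
move=> h; suff : `|real_complex R c| <= 1.
  by rewrite norm_real_complex lecE/= eqxx.
have := norm_horner0_le1 _ h.
rewrite map_monic (monic_poly_size _).2 => /(_ isT).
by rewrite -(rmorph0 (real_complex R)) horner_map horner_monic_poly_rcons mulr0 add0r.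
Qed.

End MonicPoly.

(** * Integration over tuples *)

Section TupleIntegral.
Variable R : realType.
Local Notation RT := (measurableTypeR R).
Local Notation leb := (@lebesgue_measure R).
Local Open Scope ereal_scope.

Lemma measurable_fun_integral_snd d1 d2 (T1 : measurableType d1)
    (T2 : measurableType d2) (m2 : {sigma_finite_measure set T2 -> \bar R})
    (f : T1 -> T2 -> \bar R) :
  measurable_fun [set: T1 * T2] (fun p => f p.1 p.2) ->
  (forall x y, 0 <= f x y) ->
  measurable_fun [set: T1] (fun x => \int[m2]_y f x y).
Proof.
move=> mf f0.
exact: (@measurable_fun_fubini_tonelli_F _ _ _ _ _ m2 _ mf (fun p => f0 p.1 p.2)).
Qed.

Lemma integral_exchange d1 d2 (T1 : measurableType d1) (T2 : measurableType d2)
    (m1 : {sigma_finite_measure set T1 -> \bar R})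
    (m2 : {sigma_finite_measure set T2 -> \bar R}) (f : T1 -> T2 -> \bar R) :
  measurable_fun [set: T1 * T2] (fun p => f p.1 p.2) ->
  (forall x y, 0 <= f x y) ->
  \int[m1]_x \int[m2]_y f x y = \int[m2]_y \int[m1]_x f x y.
Proof.
move=> mf f0.
exact: (@fubini_tonelli _ _ _ _ _ m1 m2 _ mf (fun p => f0 p.1 p.2)).
Qed.

Lemma lebesgue_measure_affine (a b : R) (A : set RT) : (0 < a)%R -> measurable A ->
  leb A = a%:E * leb ((fun x : R => a * x + b)%R @^-1` A).
Proof.
move=> a0 mA; have mh : measurable_fun [set: RT] (fun x : R => a * x + b : RT)%R.
  by apply: measurable_funD => //; exact: measurable_funM.
pose a' : {nonneg R} := NngNum (ltW a0).
pose nu : {measure set RT -> \bar R} :=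
  measure_function_pushforward__canonical__measure_function_Measure leb mh.
apply: (@lebesgue_measure_unique R (mscale a' nu)) => //= _ [[c d]] _ <-.
rewrite /mscale/= /nu/= /pushforward.
have -> : (fun x : R => (a * x + b)%R) @^-1` `]c, d]%classic =
    `](((c - b) / a)%R), (((d - b) / a)%R)]%classic :> set R.
  apply/seteqP; split=> x; rewrite /= !in_itv/= ltr_pdivrMr// ler_pdivlMr// => /andP[h1 h2];
   apply/andP; split; lra.
rewrite !lebesgue_measure_itv/= !lte_fin ltr_pM2r ?invr_gt0// ltrD2r.
case: ifP => _; last by rewrite mule0.
by rewrite -!EFinD -EFinM; congr EFin; field; rewrite gt_eqF.
Qed.

Lemma integral_affine (a b : R) (f : RT -> \bar R) : (0 < a)%R ->
  measurable_fun [set: RT] f -> (forall x, 0 <= f x) ->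
  \int[leb]_x f x = a%:E * \int[leb]_x f (a * x + b)%R.
Proof.
move=> a0 mf f0; have mh : measurable_fun [set: RT] (fun x : R => a * x + b : RT)%R.
  by apply: measurable_funD => //; exact: measurable_funM.
pose a' : {nonneg R} := NngNum (ltW a0).
pose nu : {measure set RT -> \bar R} :=
  measure_function_pushforward__canonical__measure_function_Measure leb mh.
transitivity (\int[mscale a' nu]_x f x).
  apply: eq_measure_integral => A mA _.
  exact: lebesgue_measure_affine.
rewrite ge0_integral_mscale//; congr (_ * _).
by rewrite ge0_integral_pushforward.
Qed.

Lemma integral_tuple_cons n (f : n.+1.-tuple RT -> \bar R) :
  measurable_fun [set: n.+1.-tuple RT] f -> (forall t, 0 <= f t) ->
  \int[lebesgue_tuple R n.+1]_t f t =
  \int[leb]_x \int[lebesgue_tuple R n]_t f [tuple of x :: t].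
Proof.
move=> mf f0.
have mc := @measurable_tuple_cons R n.
transitivity (\int[pushforward (leb \x lebesgue_tuple R n) (@tuple_cons R n)]_t f t).
  by apply: eq_measure_integral.
rewrite ge0_integral_pushforward//= preimage_setT.
by rewrite fubini_tonelli1//; exact: measurableT_comp.
Qed.

Lemma measurable_tuple_rcons n : measurable_fun [set: n.-tuple RT * RT]
  (fun p => [tuple of rcons p.1 p.2] : n.+1.-tuple RT).
Proof.
apply/measurable_fun_tnthP => i.
have [->|[j ->]] : i = ord_max \/ exists j, i = widen_ord (leqnSn n) j.
  have [ni|ni] := ltnP i n; last by left; apply/val_inj => /=; have := ltn_ord i; lia.
  by right; exists (Ordinal ni); apply/val_inj.
- rewrite (_ : _ \o _ = snd); first exact: measurable_snd.
  by apply/funext => -[t c] /=; rewrite (@tnth_rcons_r n _ t c ord_max).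
- rewrite (_ : _ \o _ = (fun t : n.-tuple RT => tnth t j) \o fst).
    by apply: measurableT_comp; [exact: measurable_tnth|exact: measurable_fst].
  by apply/funext => -[t c] /=; rewrite (@tnth_rcons_l n _ t c j).
Qed.

Lemma measurable_fun_tuple_rcons d (T : measurableType d) n (g : T -> n.-tuple RT) (h : T -> RT) :
  measurable_fun [set: T] g -> measurable_fun [set: T] h ->
  measurable_fun [set: T] (fun x => [tuple of rcons (g x) (h x)] : n.+1.-tuple RT).
Proof.
move=> mg mh.
exact: measurableT_comp (@measurable_tuple_rcons n) (measurable_fun_pair mg mh).
Qed.

Lemma measurable_fun_tuple_cons d (T : measurableType d) n (h : T -> RT) (g : T -> n.-tuple RT) :
  measurable_fun [set: T] h -> measurable_fun [set: T] g ->
  measurable_fun [set: T] (fun x => [tuple of h x :: g x] : n.+1.-tuple RT).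
Proof.
move=> mh mg.
exact: measurableT_comp (@measurable_tuple_cons R n) (measurable_fun_pair mh mg).
Qed.

Lemma integral_tuple0 (f : 0.-tuple RT -> \bar R) :
  measurable_fun [set: 0.-tuple RT] f ->
  \int[lebesgue_tuple R 0]_t f t = f [tuple].
Proof. by move=> mf; rewrite /= integral_dirac// diracT mul1e. Qed.

(** [lebesgue_tuple] splits off the first coefficient by construction. Both the volume recursion and
    the lines of the area formula single out the constant term, which is the last one. *)
Lemma integral_tuple_rcons n (f : n.+1.-tuple RT -> \bar R) :
  measurable_fun [set: n.+1.-tuple RT] f -> (forall t, 0 <= f t) ->
  \int[lebesgue_tuple R n.+1]_t f t =
  \int[lebesgue_tuple R n]_t \int[leb]_c f [tuple of rcons t c].
Proof.
elim: n f => [|n IH] f mf f0.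
  rewrite integral_tuple_cons// integral_tuple0.
    apply: eq_integral => x _; rewrite integral_tuple0.
      by congr f; exact/val_inj.
    apply: measurableT_comp mf _; exact: measurable_fun_tuple_cons.
  have mfr := measurableT_comp mf (@measurable_tuple_rcons 0).
  by apply: measurable_fun_integral_snd => // x y; exact: f0.
have mfr : measurable_fun [set: n.+1.-tuple RT * RT] (fun p => f [tuple of rcons p.1 p.2]).
  exact: measurableT_comp mf (@measurable_tuple_rcons n.+1).
rewrite integral_tuple_cons// [RHS]integral_tuple_cons//; last 2 first.
- by apply: measurable_fun_integral_snd => // x y; exact: f0.
- by move=> t; exact: integral_ge0.
apply: eq_integral => x _; rewrite (IH (fun t => f [tuple of x :: t])).
- apply: eq_integral => t _; apply: eq_integral => c _.
  by congr f; exact/val_inj.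
- apply: measurableT_comp mf _; exact: measurable_fun_tuple_cons.
- by move=> t; exact: f0.
Qed.

End TupleIntegral.

(** * The Jacobian of the Schur-Cohn map *)

Section SchurIntegral.
Variable R : realType.
Local Notation RT := (measurableTypeR R).
Local Notation leb := (@lebesgue_measure R).
Local Open Scope ereal_scope.

Lemma integral2_shear (k : R) (h : RT -> RT -> \bar R) : (`|k| < 1)%R ->
  measurable_fun [set: RT * RT] (fun p => h p.1 p.2) ->
  (forall x y, 0 <= h x y) ->
  \int[leb]_x \int[leb]_y h x y =
  (1 - k ^+ 2)%:E * \int[leb]_x \int[leb]_y h (x + k * y)%R (y + k * x)%R.
Proof.
move=> k1 mh h0.
have k2 : (0 < 1 - k ^+ 2)%R by move: k1; rewrite ltr_norml => /andP[? ?]; nra.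
have mc d (T : measurableType d) (u v : T -> RT) : measurable_fun [set: T] u ->
    measurable_fun [set: T] v -> measurable_fun [set: T] (fun p => h (u p) (v p)).
  by move=> mu mv; exact: measurableT_comp mh (measurable_fun_pair mu mv).
have m1 : measurable_fun [set: RT * RT] (fst : RT * RT -> RT) by exact: measurable_fst.
have m2 : measurable_fun [set: RT * RT] (snd : RT * RT -> RT) by exact: measurable_snd.
have mk (u : RT * RT -> RT) (a : R) : measurable_fun [set: RT * RT] u ->
    measurable_fun [set: RT * RT] (fun p => (a * u p)%R : RT).
  by move=> mu; apply: measurable_funM.
have mD (u v : RT * RT -> RT) : measurable_fun [set: RT * RT] u ->
    measurable_fun [set: RT * RT] v ->
    measurable_fun [set: RT * RT] (fun p => (u p + v p)%R : RT).
  by move=> mu mv; apply: measurable_funD.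
(* The linear map is a shear followed by a dilation: with x' = x + k y, the second argument is (1 -
   k^2) y + k x'. The factor 1 - k^2 comes from the dilation in y alone. *)
have -> : \int[leb]_x \int[leb]_y h (x + k * y)%R (y + k * x)%R =
          \int[leb]_y \int[leb]_x h x ((1 - k ^+ 2) * y + k * x)%R.
  rewrite integral_exchange; last 2 first.
  - by apply: mc; apply: (mD) => //; apply: mk.
  - by move=> x y; exact: h0.
  apply: eq_integral => y _.
  rewrite [RHS](@integral_affine _ 1 (k * y)%R _ ltr01).
  - rewrite mul1e; apply: eq_integral => x _; congr (h _ _); ring.
  - by apply: mc => //; apply: measurable_funD => //; apply: measurable_funM.
  - by move=> x; exact: h0.
rewrite [in RHS]integral_exchange; last 2 first.
- by apply: mc => //; apply: mD; apply: mk.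
- by move=> x y; exact: h0.
rewrite -ge0_integralZl//; last 3 first.
- apply: measurable_fun_integral_snd; last by move=> x y; exact: h0.
  by apply: mc => //; apply: mD; apply: mk.
- by move=> x _; apply: integral_ge0 => y _; exact: h0.
- by rewrite lee_fin ltW.
apply: eq_integral => x _.
rewrite (@integral_affine _ _ (k * x)%R _ k2)//.
exact: mc.
Qed.

(** Each pair of coefficients symmetric about the middle contributes the determinant 1 - k^2; for
    odd n the middle coefficient is paired with itself and is multiplied by 1 + k. *)
Fixpoint schur_jacobian n (k : R) : R :=
  match n with
  | 0 => 1
  | 1 => 1 + k
  | m.+2 => (1 - k ^+ 2) * schur_jacobian m k
  end%R.

Lemma schur_jacobian_ge0 n k : (`|k| < 1)%R -> (0 <= schur_jacobian n k)%R.
Proof.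
move=> k1; have k2 : (0 < 1 - k ^+ 2)%R by move: k1; rewrite ltr_norml => /andP[? ?]; nra.
suff : (0 <= schur_jacobian n k /\ 0 <= schur_jacobian n.+1 k)%R by case.
elim: n => [|n [IH1 IH2]] /=.
  by split => //; move: k1; rewrite ltr_norml; lra.
by split => //; apply: mulr_ge0 => //; exact: ltW.
Qed.

Lemma measurable_schur_map n k :
  measurable_fun [set: n.-tuple RT] (schur_map k : n.-tuple RT -> n.-tuple RT).
Proof.
apply/measurable_fun_tnthP => i.
rewrite (_ : _ \o _ = fun t : n.-tuple RT => tnth t i + k * tnth t (rev_ord i))%R.
  by apply: measurable_funD; [|apply: measurable_funM => //]; exact: measurable_tnth.
by apply/funext => t /=; rewrite tnth_schur_map.
Qed.

Lemma schur_map_cons_rcons n k x (t : n.-tuple R) y :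
  schur_map k [tuple of x :: [tuple of rcons t y]] =
  [tuple of (x + k * y)%R :: [tuple of rcons (schur_map k t) (y + k * x)%R]].
Proof.
apply/val_inj => /=; rewrite rev_cons rev_rcons /= zip_rcons ?size_rev// map_rcons//.
Qed.

Lemma integral_tuple_cons_rcons n (f : n.+2.-tuple RT -> \bar R) :
  measurable_fun [set: n.+2.-tuple RT] f -> (forall t, 0 <= f t) ->
  \int[lebesgue_tuple R n.+2]_t f t =
  \int[leb]_x \int[leb]_y \int[lebesgue_tuple R n]_t
     f [tuple of x :: [tuple of rcons t y]].
Proof.
move=> mf f0; rewrite integral_tuple_cons//.
apply: eq_integral => x _.
have mfx : measurable_fun [set: n.+1.-tuple RT] (fun t : n.+1.-tuple RT => f [tuple of x :: t]).
  by apply: (measurableT_comp mf); exact: measurable_fun_tuple_cons.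
rewrite (integral_tuple_rcons mfx)// integral_exchange//.
exact: measurableT_comp mfx (@measurable_tuple_rcons R n).
Qed.

Lemma integral_schur_map n k (f : n.-tuple RT -> \bar R) : (`|k| < 1)%R ->
  measurable_fun [set: n.-tuple RT] f -> (forall t, 0 <= f t) ->
  \int[lebesgue_tuple R n]_t f t =
  (schur_jacobian n k)%:E * \int[lebesgue_tuple R n]_t f (schur_map k t).
Proof.
move=> k1.
pose P n := forall f : n.-tuple RT -> \bar R,
  measurable_fun [set: n.-tuple RT] f -> (forall t, 0 <= f t) ->
  \int[lebesgue_tuple R n]_t f t =
  (schur_jacobian n k)%:E * \int[lebesgue_tuple R n]_t f (schur_map k t).
(* The induction removes the outermost pair of coefficients, hence advances by two. *)
suff : P n /\ P n.+1 by case=> + _; exact.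
elim: {f}n => [|n [IH1 IH2]]; split => //.
- move=> f mf f0; rewrite /= mul1e !integral_tuple0//.
    by congr f; exact/val_inj.
  exact: measurableT_comp mf (@measurable_schur_map 0 k).
- move=> f mf f0.
  have mfS := measurableT_comp mf (@measurable_schur_map 1 k).
  rewrite !integral_tuple_cons//=.
  have k2 : (0 < 1 + k)%R by move: k1; rewrite ltr_norml; lra.
  rewrite (integral_affine 0 k2); last 2 first.
  - apply: measurable_fun_integral_snd => [|x t]; last exact: f0.
    exact: measurableT_comp mf (@measurable_tuple_cons R 0).
  - by move=> x; apply: integral_ge0 => t _; exact: f0.
  congr (_ * _); apply: eq_integral => x _; apply: eq_integral => t _.
  congr f; apply/val_inj; rewrite /= (tuple0 t)/=; congr [:: _]; ring.
- move=> f mf f0.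
  have mfS := measurableT_comp mf (@measurable_schur_map n.+2 k).
  rewrite !integral_tuple_cons_rcons//=.
  pose F x y := \int[lebesgue_tuple R n]_t f [tuple of x :: [tuple of rcons t y]].
  pose G x y := \int[lebesgue_tuple R n]_t
    f [tuple of x :: [tuple of rcons (schur_map k t) y]].
  have mcr (g : n.+2.-tuple RT -> \bar R) : measurable_fun [set: n.+2.-tuple RT] g ->
      measurable_fun [set: (RT * RT) * n.-tuple RT]
        (fun p => g [tuple of p.1.1 :: [tuple of rcons p.2 p.1.2]]).
    move=> mg; apply: (measurableT_comp mg); apply: measurable_fun_tuple_cons.
      exact: measurableT_comp measurable_fst measurable_fst.
    apply: measurable_fun_tuple_rcons; first exact: measurable_snd.
    exact: measurableT_comp measurable_snd measurable_fst.
  have FG x y : F x y = (schur_jacobian n k)%:E * G x y.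
    rewrite /F (IH1 (fun t => f [tuple of x :: [tuple of rcons t y]]))//.
    apply: (measurableT_comp mf); apply: measurable_fun_tuple_cons => //.
    exact: measurable_fun_tuple_rcons.
  have GS x y : G (x + k * y)%R (y + k * x)%R =
      \int[lebesgue_tuple R n]_t f (schur_map k [tuple of x :: [tuple of rcons t y]]).
    by apply: eq_integral => t _; rewrite schur_map_cons_rcons.
  transitivity (\int[leb]_x \int[leb]_y F x y); first by [].
  rewrite (@integral2_shear k F k1); last 2 first.
  - apply: (measurable_fun_integral_snd (T1 := (RT * RT)%type)); first exact: mcr mf.
    by move=> p t; exact: f0.
  - by move=> x y; apply: integral_ge0 => t _; exact: f0.
  have mG : measurable_fun [set: RT * RT]
      (fun p => \int[lebesgue_tuple R n]_t
         f (schur_map k [tuple of p.1 :: [tuple of rcons t p.2]])).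
    apply: (measurable_fun_integral_snd (T1 := (RT * RT)%type)); first exact: mcr mfS.
    by move=> p t; exact: f0.
  have G0 x y : 0 <= \int[lebesgue_tuple R n]_t
         f (schur_map k [tuple of x :: [tuple of rcons t y]]).
    by apply: integral_ge0 => t _; exact: f0.
  have J0 := schur_jacobian_ge0 n k1.
  rewrite EFinM -muleA; congr (_ * _).
  rewrite -ge0_integralZl//; last 2 first.
  - by apply: measurable_fun_integral_snd.
  - by move=> x _; apply: integral_ge0 => y _; exact: G0.
  apply: eq_integral => x _; rewrite -ge0_integralZl//.
  - by apply: eq_integral => y _; rewrite FG GS.
  - have mp : measurable_fun [set: RT] (fun y : RT => (x, y) : RT * RT).
      by apply: measurable_fun_pair.
    exact: measurableT_comp mG mp.
Qed.

End SchurIntegral.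

(** * Measurability and volume of Omega *)

Section Measurability.
Variable R : realType.
Local Notation RT := (measurableTypeR R).

Lemma horner_monic n (t : n.-tuple R) (x : R) :
  (monic_poly t).[x] = x ^+ n + \sum_(i < n) tnth t i * x ^+ (n - i.+1).
Proof.
rewrite /monic_poly hornerD horner_sum hornerXn; congr (_ + _).
by apply: eq_bigr => i _; rewrite hornerZ hornerXn.
Qed.

Lemma measurable_fun_horner_monic d (T : measurableType d) n
    (g : T -> n.-tuple RT) (h : T -> RT) :
  measurable_fun [set: T] g -> measurable_fun [set: T] h ->
  measurable_fun [set: T] (fun x => (monic_poly (g x)).[h x] : RT).
Proof.
move=> mg mh; under eq_fun do rewrite horner_monic.
apply: measurable_funD; first exact: measurable_funX.
apply: measurable_sum => i; apply: measurable_funM; last exact: measurable_funX.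
exact: measurableT_comp (measurable_tnth i) mg.
Qed.

Lemma measurable_fun_synthetic_div d (T : measurableType d) n
    (h k : T -> RT) (g : T -> n.-tuple RT) :
  measurable_fun [set: T] h -> measurable_fun [set: T] k ->
  measurable_fun [set: T] g ->
  measurable_fun [set: T] (fun x => synthetic_div (h x) (k x) (g x) : n.-tuple RT).
Proof.
elim: n k g => [|n IH] k g mh mk mg.
  rewrite (_ : (fun _ => _) = cst [tuple]); first exact: measurable_cst.
  by apply/funext => x; rewrite tuple0.
have mhd : measurable_fun [set: T] (fun x => thead (g x) + h x * k x : RT).
  apply: measurable_funD; last exact: measurable_funM.
  exact: measurableT_comp (measurable_tnth ord0) mg.
have mtl : measurable_fun [set: T] (fun x => [tuple of behead (g x)] : n.-tuple RT).
  exact: measurableT_comp (@measurable_behead _ _ n) mg.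
rewrite (_ : (fun _ => _) = (fun x => [tuple of (thead (g x) + h x * k x) ::
    synthetic_div (h x) (thead (g x) + h x * k x) [tuple of behead (g x)]])).
  by apply: measurable_fun_tuple_cons => //; exact: IH.
apply/funext => x; case/tupleP: (g x) => a t; apply/val_inj => /=.
by rewrite theadE.
Qed.

Let re (z : R[i]) : R := complex.Re z.
Let im (z : R[i]) : R := complex.Im z.

Lemma horner_map_monic_Re n (t : n.-tuple R) (z : R[i]) :
  re (map_poly (real_complex R) (monic_poly t)).[z] =
  re (z ^+ n) + \sum_(i < n) tnth t i * re (z ^+ (n - i.+1)) /\
  im (map_poly (real_complex R) (monic_poly t)).[z] =
  im (z ^+ n) + \sum_(i < n) tnth t i * im (z ^+ (n - i.+1)).
Proof.
rewrite horner_map_monic; set f := fun i : 'I_n => _; set s := z ^+ n.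
have hs (I : Type) (r : seq I) (c : I -> R) (w : I -> R[i]) :
   re (\sum_(i <- r) real_complex R (c i) * w i) = \sum_(i <- r) c i * re (w i) /\
   im (\sum_(i <- r) real_complex R (c i) * w i) = \sum_(i <- r) c i * im (w i).
  elim: r => [|i r [IH1 IH2]]; first by rewrite !big_nil.
  rewrite !big_cons -IH1 -IH2; case: (w i) => a b.
  case: (\sum_(j <- r) _) => a' b'; rewrite /re /im /=; split; ring.
have [h1 h2] := hs _ (index_enum 'I_n) (fun i => tnth t i) (fun i => z ^+ (n - i.+1)).
rewrite -h1 -h2 /f.
by case: s => a b; case: (\sum_(i < n) _) => a' b'.
Qed.

Lemma rat_point_close (z : R[i]) (e : R) : 0 < e ->
  exists q : rat * rat, `|(ratr q.1 +i* ratr q.2)%C - z| <= real_complex R (2 * e).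
Proof.
move=> e0; case: z => a b.
have [q1] : exists q, ratr q \in `]a - e, (a + e)[ by apply: rat_in_itvoo; lra.
have [q2] : exists q, ratr q \in `]b - e, (b + e)[ by apply: rat_in_itvoo; lra.
rewrite !in_itv/= => /andP[b1 b2] /andP[a1 a2]; exists (q1, q2) => /=.
rewrite normc_def/= lecR -[leRHS]ger0_norm; last lra.
rewrite -sqrtr_sqr ler_wsqrtr//; nra.
Qed.

Lemma horner_bounded (p : {poly R[i]}) (b : R) : exists2 M : R, 0 < M &
  forall z, `|z| <= real_complex R b -> `|p.[z]| <= real_complex R M.
Proof.
elim/poly_ind: p => [|p c [M M0 IH]].
  by exists 1 => // z _; rewrite horner0 normr0 lecR.
exists (M * `|b| + complex.Re `|c| + 1).
  have : 0 <= complex.Re `|c| by rewrite normc_def /= sqrtr_ge0.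
  have := mulr_ge0 (ltW M0) (normr_ge0 b); lra.
move=> z zb; rewrite hornerMXaddC (le_trans (ler_normD _ _))//.
rewrite normrM !rmorphD rmorphM/=.
have -> : real_complex R (complex.Re `|c|) = `|c| by rewrite RRe_real// normr_real.
rewrite -addrA lerD//; last by rewrite lerDl lecR.
rewrite ler_pM ?IH//; apply: le_trans zb _; rewrite lecR; exact: ler_norm.
Qed.

(* Only countably many points have to be tested: a root outside the disk makes
   the inequality fail at rational points near it. *)
Lemma disk_rootsP n (t : n.-tuple R) :
  disk_roots (monic_poly t) <->
  forall q : rat * rat, let z := (ratr q.1 +i* ratr q.2 : R[i])%C in
    1 < `|z| -> (`|z| - 1) ^+ n <= `|(map_poly (real_complex R) (monic_poly t)).[z]|.
Proof.
set P := map_poly _ _.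
have sP : (size P).-1 = n by rewrite size_map_poly (monic_poly_size _).1.
have mP : P \is monic by rewrite map_monic (monic_poly_size _).2.
split=> [h q z z1|h z0 rz0].
  by rewrite -sP; apply: norm_horner_ge => //; exact: ltW.
rewrite real_leNgt ?normr_real ?real1//; apply/negP => z1.
have [Q PQ] : exists Q, P = Q * ('X - z0%:P) by apply/factor_theorem.
have [r zr] : exists r : R, `|z0| = real_complex R r.
  by apply/complex_realP; rewrite normr_real.
rewrite zr ltcR in z1.
have [M M0 QM] := horner_bounded Q (r + 1).
pose D := (r - 1) / 2; have D0 : 0 < D by rewrite /D; lra.
(* Here |z0| = 1 + 2 D. The three bounds keep |z| >= 1 + D, keep z where Q is bounded by M, and make
   |P(z)| <= 2 e M <= D^n / 2, below the required D^n. *)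
pose e := Num.min (D / 2) (Num.min (1 / 2) (D ^+ n / M / 4)).
have e0 : 0 < e.
  rewrite /e !lt_min; apply/and3P; split; [lra|lra|].
  by rewrite divr_gt0// divr_gt0// exprn_gt0.
have [q qz] := rat_point_close z0 e0.
set z := (_ +i* _)%C in qz.
have e1 : 2 * e <= D by have : e <= D / 2; [rewrite ge_min lexx|lra].
have e2 : 2 * e <= 1 by have : e <= 1 / 2; [rewrite /e !ge_min lexx ?orbT|lra].
have e3 : e <= D ^+ n / M / 4 by rewrite /e !ge_min lexx ?orbT.
have z_ub : `|z| <= real_complex R (r + 1).
  rewrite -(subrK z0 z) (le_trans (ler_normD _ _))// [leLHS]addrC zr rmorphD lerD2l.
  by rewrite (le_trans qz)// lecR.
have z_lb : real_complex R (1 + D) <= `|z|.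
  rewrite -(lerD2r `|z - z0|) -[`|z - z0|]normrN opprB [leRHS]addrC.
  apply: (le_trans _ (ler_normD _ _)); rewrite subrK zr -normrN opprB.
  apply: (le_trans (lerD (lexx _) qz)); rewrite -rmorphD lecR /D; move: e1; rewrite /D; lra.
have z_gt1 : 1 < `|z|.
  by apply: lt_le_trans z_lb; rewrite -[1]/(real_complex R 1) ltcR; lra.
have := h q z_gt1; rewrite /= -/z PQ hornerM hornerXsubC normrM => hz.
have : real_complex R (D ^+ n) <= real_complex R (M * (2 * e)).
  rewrite rmorphM rmorphXn/=; apply: (le_trans _ (le_trans hz _)).
    have D0C : real_complex R 0 <= real_complex R D by rewrite lecR ltW.
    have z0C : 0 <= `|z| - 1 by rewrite subr_ge0 (ltW z_gt1).
    rewrite lerXn2r ?nnegrE//.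
    by rewrite lerBrDl -[1]/(real_complex R 1) -rmorphD.
  by rewrite ler_pM// QM.
rewrite lecR => le_e; have Dn : 0 < D ^+ n by rewrite exprn_gt0.
move: e3; rewrite ler_pdivlMr// ler_pdivlMr//; lra.
Qed.

Lemma measurable_Omega n : measurable (@Omega R n).
Proof.
pose B (q : rat * rat) : set (n.-tuple RT) :=
  let z := (ratr q.1 +i* ratr q.2 : R[i])%C in
  if 1 < `|z| then [set a : n.-tuple RT |
    ~~ ((`|z| - 1) ^+ n <= `|(map_poly (real_complex R) (monic_poly a)).[z]|)] else set0.
have -> : @Omega R n = ~` \bigcup_q B q.
  apply/seteqP; split => [a /disk_rootsP h [q _]|a h].
    rewrite /B; case: ifP => // z1 /=; rewrite h//.
  apply/disk_rootsP => q z z1; apply: contrapT => /negP nz.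
  by apply: h; exists q => //; rewrite /B z1.
apply: measurableC; apply: countable_bigcupT_measurable => [|q].
  exact: countableP.
rewrite /B; set z := (_ +i* _)%C; case: ifP => // z1.
have [c cz] : exists c : R, (`|z| - 1) ^+ n = real_complex R c.
  by apply/complex_realP; rewrite rpredX// rpredB ?normr_real ?real1.
have c0 : 0 <= c by rewrite -lecR -cz exprn_ge0// subr_ge0 ltW.
pose rz i := complex.Re (z ^+ i); pose iz i := complex.Im (z ^+ i).
pose f (a : n.-tuple RT) : RT := (rz n + \sum_(i < n) tnth a i * rz (n - i.+1)%N) ^+ 2 +
  (iz n + \sum_(i < n) tnth a i * iz (n - i.+1)%N) ^+ 2.
have mf : measurable_fun [set: n.-tuple RT] f.
  apply: measurable_funD; apply: measurable_funX; apply: measurable_funD => //;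
  by apply: measurable_sum => i; apply: measurable_funM => //; exact: measurable_tnth.
rewrite (_ : [set _ | _] = ~` [set a | c ^+ 2 <= f a]).
  apply: measurableC; rewrite -[X in measurable X]setTI.
  by apply: (measurable_fun_ler _ mf) => //; exact: measurable_cst.
have key a : ((`|z| - 1) ^+ n <=
    `|(map_poly (real_complex R) (monic_poly a)).[z]|) = (c ^+ 2 <= f a).
  have [h1 h2] := horner_map_monic_Re a z.
  rewrite /re in h1; rewrite /im in h2.
  rewrite cz normc_def h1 h2 lecR -{1}(ger0_norm c0) -sqrtr_sqr.
  by rewrite ler_sqrt// addr_ge0 ?sqr_ge0.
by apply/seteqP; split => a; rewrite /= key => /negP.
Qed.

End Measurability.

(** * The ratio of consecutive volumes *)

Section VolumeRatio.
Variable R : realType.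
Local Notation RT := (measurableTypeR R).
Local Notation leb := (@lebesgue_measure R).

Lemma integral_deriv_poly (q : {poly R}) (a b : R) : a < b ->
  (\int[leb]_(x in `[a, b]) (q^`().[x])%:E = (q.[b] - q.[a])%:E)%E.
Proof.
move=> ab; rewrite (@continuous_FTC2 _ (horner q^`()) (horner q)) ?EFinB//.
- by apply: continuous_subspaceT => x; exact: continuous_horner.
- split.
  + by move=> x _; exact: derivable_horner.
  + by apply: cvg_at_right_filter; exact: continuous_horner.
  + by apply: cvg_at_left_filter; exact: continuous_horner.
- by move=> x _; rewrite derivE.
Qed.

(** The polynomial primitive of (1 - x^2)^m vanishing at 0, by the recursion that integration by
    parts provides. *)
Fixpoint schur_primitive m : {poly R} :=
  if m is m'.+1 then (2 * m'%:R + 3)^-1 *: ('X * (1 - 'X^2) ^+ m'.+1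
      + (2 * m'%:R + 2) *: schur_primitive m')
  else 'X.

Lemma deriv_schur_primitive m : (schur_primitive m)^`() = (1 - 'X^2) ^+ m.
Proof.
elim: m => [|m IH]; first by rewrite /= derivX.
have m0 := ler0n R m.
have d2 : (1 - 'X^2 : {poly R})^`() = - (2 *: 'X).
  by rewrite derivB derivXn -polyC1 derivC sub0r expr1 scaler_nat.
rewrite /= derivZ derivD derivZ IH derivM derivX mul1r deriv_exp d2 /=.
apply: (scalerI (a := 2 * m%:R + 3)); first by apply/eqP; lra.
rewrite scalerA mulfV ?scale1r; last by apply/eqP; lra.
rewrite exprS; set u := (1 - 'X^2) ^+ m.
rewrite -scaler_nat -[X in X *: (_ * u)]natr1 -!mul_polyC !polyCD !polyCM.
ring.
Qed.

Lemma schur_primitive_val m : (schur_primitive m).[1] = (wbin R m)^-1 /\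
  (schur_primitive m).[-1] = - (wbin R m)^-1.
Proof.
elim: m => [|m [IH1 IH2]]; first by rewrite /= !hornerX /wbin pbin0 mulr0 add0r mulr1 invr1.
have m0 := ler0n R m; have p0 := pbin_gt0 R m.
rewrite /= !hornerE IH1 IH2 expr1n sqrrN expr1n subrr expr0n/= !(mulr0, mul0r) !add0r.
rewrite /wbin -[m.+1%:R]natr1 pbinSE; split; field.
all: by rewrite gt_eqF//=; apply/and3P; split; apply/eqP; lra.
Qed.

Lemma schur_jacobianE n (k : R) : schur_jacobian n k = (1 - k ^+ 2) ^+ n./2 * (1 + k) ^+ odd n.
Proof.
suff : schur_jacobian n k = (1 - k ^+ 2) ^+ n./2 * (1 + k) ^+ odd n /\
  schur_jacobian n.+1 k = (1 - k ^+ 2) ^+ n.+1./2 * (1 + k) ^+ odd n.+1 by case.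
elim: n => [|n [IH1 IH2]]; first by rewrite /= !expr0 !mul1r expr1.
split => //; rewrite [LHS]/= IH1 mulrA -exprS. 
by congr (_ ^+ _ * _ ^+ _); rewrite /= ?negbK.
Qed.

(** For odd n the Jacobian has the additional odd part k (1 - k^2)^(n./2). Its primitive vanishes at
    both ends of [-1, 1], which is why the volume ratio depends on n only through [n./2]. *)
Definition jacobian_primitive n : {poly R} := schur_primitive n./2 -
  (odd n)%:R / (2 * (n./2)%:R + 2) *: (1 - 'X^2) ^+ (n./2).+1.

Lemma deriv_jacobian_primitive n (k : R) :
  (jacobian_primitive n)^`().[k] = schur_jacobian n k.
Proof.
have m0 := ler0n R n./2.
have d2 : (1 - 'X^2 : {poly R})^`() = - (2 *: 'X).
  by rewrite derivB derivXn -polyC1 derivC sub0r expr1 scaler_nat.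
rewrite /jacobian_primitive derivB deriv_schur_primitive derivZ deriv_exp d2 /=.
rewrite !(hornerE, hornerMn) schur_jacobianE.
rewrite -[_ *+ n./2.+1]mulr_natr -[n./2.+1%:R]natr1.
case: (odd n) => /=; rewrite ?mulr0n ?mulr1n; last by ring.
by field; apply/eqP; lra.
Qed.

Lemma integral_schur_jacobian n :
  (\int[leb]_(x in `[(- 1 : R)%R, (1 : R)%R]) (@schur_jacobian R n x)%:E = (2 / wbin R n./2)%:E)%E.
Proof.
under eq_integral do rewrite -deriv_jacobian_primitive.
rewrite integral_deriv_poly; last lra.
have [h1 h2] := schur_primitive_val n./2.
rewrite /jacobian_primitive !hornerE h1 h2 expr1n sqrrN expr1n subrr expr0n/=.
by rewrite !mulr0 !subr0; congr EFin; ring.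
Qed.

Local Open Scope ereal_scope.

Lemma measurable_indic_Omega n :
  measurable_fun [set: n.-tuple RT] (fun t => (\1_(@Omega R n) t)%:E : \bar R).
Proof. by apply/measurable_EFinP; apply: measurable_indic; exact: measurable_Omega. Qed.

Lemma lebesgue_OmegaE n :
  lebesgue_tuple R n (@Omega R n) = \int[lebesgue_tuple R n]_t (\1_(@Omega R n) t)%:E.
Proof. by rewrite integral_indic ?setIT//; exact: measurable_Omega. Qed.

Lemma lebesgue_Omega_rec n : lebesgue_tuple R n.+1 (@Omega R n.+1) =
  (2 / wbin R n./2)%:E * lebesgue_tuple R n (@Omega R n).
Proof.
have mO := measurable_indic_Omega.
rewrite lebesgue_OmegaE integral_tuple_rcons//.
have mr : measurable_fun [set: n.-tuple RT * RT]
    (fun p => (\1_(@Omega R n.+1) [tuple of rcons p.1 p.2])%:E : \bar R).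
  exact: measurableT_comp (mO n.+1) (@measurable_tuple_rcons R n).
rewrite integral_exchange//.
set phi := fun c : R => \int[_]_t _.
have mphi : measurable_fun [set: RT] (phi : RT -> \bar R).
  apply: measurable_fun_integral_snd; last by move=> x y; rewrite lee_fin.
  exact: measurableT_comp mr (@measurable_swap _ _ _ _).
(* The constant term is, up to sign, the product of the roots, so the slices with |c| > 1 are
   empty. *)
rewrite (_ : \int[leb]_c phi c = \int[leb]_(c in `[(- 1 : R)%R, (1 : R)%R]) phi c); last first.
  rewrite [RHS]integral_mkcond; apply: eq_integral => c _.
  rewrite /patch; case: ifPn => // cn; rewrite /phi integral0_eq// => t _.
  rewrite indicE memNset// => /disk_roots_last c1; move: cn; rewrite mem_setE in_itv/=.
  by rewrite -ler_norml c1.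
rewrite -integral_schur_jacobian.
have mJ (D : set RT) : measurable_fun D (fun x : RT => (@schur_jacobian R n x)%:E : \bar R).
  have e : (fun x : RT => (@schur_jacobian R n x)%:E : \bar R) =
      EFin \o horner (jacobian_primitive n)^`().
    by apply/funext => x /=; rewrite deriv_jacobian_primitive.
  rewrite e; apply/measurable_EFinP; apply: measurable_funTS.
  exact: continuous_measurable_fun (@continuous_horner R _).
(* The Schur-Cohn map is invertible only for |c| < 1; the two endpoints form a null set. *)
transitivity (\int[leb]_(c in `](- 1 : R)%R, (1 : R)%R[) phi c).
  by apply: integral_itv_bndoo; apply: measurable_funTS; exact: mphi.
transitivity ((\int[leb]_(x in `](- 1 : R)%R, (1 : R)%R[) (schur_jacobian n x)%:E) *
    lebesgue_tuple R n (@Omega R n)); last first.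
  by congr (_ * _); apply/esym; apply: integral_itv_bndoo; exact: mJ.
rewrite -ge0_integralZr//.
- apply: eq_integral => c; rewrite mem_setE in_itv/= -ltr_norml => c1.
  rewrite /phi (integral_schur_map c1); last 2 first.
  + exact: measurableT_comp (mO n.+1) (measurable_fun_tuple_rcons _ _).
  + by move=> t; rewrite lee_fin.
  rewrite lebesgue_OmegaE; congr (_ * _); apply: eq_integral => t _.
  congr EFin; rewrite !indicE; congr (_%:R); congr nat_of_bool.
  have [h1 h2] := @disk_roots_schur R n c t c1.
  by apply/idP/idP; rewrite !inE.
- move=> c /=; rewrite in_itv/= -ltr_norml => c1.
  by rewrite lee_fin schur_jacobian_ge0.
Qed.

Lemma lebesgue_Omega_fin n : exists2 d : R, (0 < d)%R &
  lebesgue_tuple R n (@Omega R n) = d%:E.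
Proof.
elim: n => [|n [d d0 IH]].
  exists 1%R => //; rewrite /= diracE mem_set// => z.
  by rewrite monic_poly0 rmorph1 rootE hornerC oner_eq0.
exists (2 / wbin R n./2 * d)%R; first by rewrite mulr_gt0// divr_gt0// wbin_gt0.
by rewrite lebesgue_Omega_rec IH EFinM.
Qed.

Lemma volume_Omega_gt0 n : (0 < volume_Omega R n)%R.
Proof. by rewrite /volume_Omega; have [d d0 ->] := lebesgue_Omega_fin n. Qed.

Lemma volume_Omega_rec n :
  volume_Omega R n.+1 = (2 / wbin R n./2 * volume_Omega R n)%R.
Proof.
by rewrite /volume_Omega lebesgue_Omega_rec; have [d d0 ->] := lebesgue_Omega_fin n.
Qed.

End VolumeRatio.

(** * The area formula for polynomials *)

Section DensityMeasure.
Context d (T : measurableType d) (R : realType) (mu : {measure set T -> \bar R}).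
Variables (f : T -> \bar R) (mf : measurable_fun [set: T] f) (f0 : forall x, (0 <= f x)%E).

(** The two proofs are arguments so that the measure structure can be attached to the term
    itself. *)
Definition density_measure of measurable_fun [set: T] f & (forall x, (0 <= f x)%E) :=
  fun A : set T => (\int[mu]_(x in A) f x)%E.
Local Notation nu := (density_measure mf f0).

Let nu0 : nu set0 = 0%E. Proof. exact: integral_set0. Qed.
Let nu_ge0 A : (0 <= nu A)%E. Proof. by apply: integral_ge0 => x _. Qed.
Let nu_sigma_additive : semi_sigma_additive nu.
Proof. exact: semi_sigma_additive_nng_induced. Qed.

HB.instance Definition _ := isMeasure.Build _ _ _ nu nu0 nu_ge0 nu_sigma_additive.
End DensityMeasure.

Section RootCount.
Variable R : realType.
Implicit Types (p g : {poly R}) (u v w x y : R).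

(** Half-open intervals make the counts additive when an interval is cut at a critical point. *)
Definition root_count p u v : nat := count (fun x => u < x <= v) (rootsR p).

Lemma mem_rootsR p x : p != 0 -> (x \in rootsR p) = root p x.
Proof.
by move=> p0; have := roots_on_rootsR p0 x; rewrite in_itv/= => <-.
Qed.

Lemma uniq_rootsR p : uniq (rootsR p). Proof. exact: uniq_roots. Qed.

Lemma root_count_split p u w v : u <= w <= v ->
  root_count p u v = (root_count p u w + root_count p w v)%N.
Proof.
move=> /andP[uw wv]; rewrite /root_count; elim: (rootsR p) => //= x s ->.
rewrite addnACA; congr (_ + _)%N.
case: (ltP u x) => ux /=; last by rewrite ltNge (le_trans ux uw).
by case: (leP x w) => xw /=; [rewrite (le_trans xw wv)|].
Qed.

Lemma root_count_eq1 p u v x : p != 0 -> u < x <= v -> root p x ->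
  (forall y, u < y <= v -> root p y -> y = x) -> root_count p u v = 1%N.
Proof.
move=> p0 xuv rx xu; rewrite /root_count -size_filter.
have : perm_eq [seq y <- rootsR p | u < y <= v] [:: x].
  apply: uniq_perm => //; first by rewrite filter_uniq// uniq_rootsR.
  move=> y; rewrite mem_filter mem_rootsR// inE.
  by apply/andP/eqP => [[yuv ry]|->]; [exact: xu|].
by move=> /perm_size.
Qed.

Lemma root_count0 p u v : p != 0 -> (forall y, u < y <= v -> ~~ root p y) ->
  root_count p u v = 0%N.
Proof.
move=> p0 h; rewrite /root_count; apply/eqP; rewrite -leqn0 leqNgt -has_count.
apply/hasPn => y; rewrite mem_rootsR// => ry; apply/negP => /h.
by rewrite ry.
Qed.

End RootCount.

Section AreaFormula.
Variable R : realType.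
Local Notation RT := (measurableTypeR R).
Local Notation leb := (@lebesgue_measure R).
Implicit Types (g : {poly R}) (u v : R) (B : set RT).

Lemma measurable_horner g : measurable_fun [set: RT] (horner g : RT -> RT).
Proof. exact: continuous_measurable_fun (@continuous_horner R g). Qed.

Lemma measurable_horner_preimage g B : measurable B -> measurable (horner g @^-1` B : set RT).
Proof. by move=> mB; rewrite -[X in measurable X]setTI; exact: measurable_horner. Qed.

Section Monotone.
Variables (g : {poly R}) (u v : R).
Hypothesis uv : u < v.
Hypothesis gpos : forall x, x \in `]u, v[ -> 0 < (g^`()).[x].

Let gmono : {in `[u, v] &, {mono horner g : x y / x < y}}.
Proof. exact: ltr_horner. Qed.

Let gmonoW : {in `[u, v] &, {mono horner g : x y / x <= y}}.
Proof. exact: ler_horner. Qed.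

(** Truncated at 0 because a density must be nonnegative at every point, while the sign of the
    derivative is assumed only inside the open interval. *)
Let h (x : RT) : \bar R := ((Num.max 0 (g^`()).[x]) * \1_(`]u, v]%classic) x)%:E.

Let mh : measurable_fun [set: RT] h.
Proof.
apply/measurable_EFinP; apply: measurable_funM; last exact: measurable_indic.
by apply: measurable_maxr => //; exact: measurable_horner.
Qed.

Let h0 x : (0 <= h x)%E.
Proof. by rewrite lee_fin mulr_ge0// le_max lexx. Qed.

Let h_out x : ~~ (u < x <= v) -> h x = 0%E.
Proof. by move=> /negbTE xuv; rewrite /h indicE mem_setE in_itv/= xuv mulr0. Qed.

Let h_in x : u < x <= v -> h x = (Num.max 0 (g^`()).[x])%:E.
Proof. by move=> xuv; rewrite /h indicE mem_setE in_itv/= xuv mulr1. Qed.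

Lemma integral_density_itv s t : u <= s -> s <= t -> t <= v ->
  (\int[leb]_(x in `]s, t]) h x = (g.[t] - g.[s])%:E)%E.
Proof.
rewrite le_eqVlt => us; rewrite le_eqVlt => /predU1P[->|st] tv.
  by rewrite set_itv_ge ?integral_set0 ?subrr// bnd_simp -leNgt.
rewrite -integral_deriv_poly//.
transitivity (\int[leb]_(x in `]s, t[) h x)%E.
  by apply: integral_itv_bndoo; apply: measurable_funTS; exact: mh.
transitivity (\int[leb]_(x in `]s, t[) ((g^`()).[x])%:E)%E; last first.
  apply/esym; apply: integral_itv_bndoo.
  by apply/measurable_EFinP; apply: measurable_funTS; exact: measurable_horner.
apply: eq_integral => x; rewrite mem_setE in_itv/= => /andP[sx xt].
have us' : u <= s by rewrite le_eqVlt.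
have xuv : x \in `]u, v[.
  by rewrite in_itv/= (le_lt_trans us' sx) (lt_le_trans xt tv).
rewrite h_in ?(le_lt_trans us' sx) ?(le_trans (ltW xt) tv)//.
by rewrite max_r// ltW// gpos.
Qed.

Let nu : {measure set RT -> \bar R} := density_measure leb mh h0.
Let push : {measure set RT -> \bar R} :=
  measure_function_pushforward__canonical__measure_function_Measure nu (measurable_horner g).
Let J : set RT := `]g.[u], g.[v]]%classic.
Let mJ : measurable J. Proof. exact: measurable_itv. Qed.
Let mCJ : measurable (~` J). Proof. exact: measurableC mJ. Qed.
Let rest : {measure set RT -> \bar R} := mrestr leb mCJ.

Let gle : g.[u] <= g.[v].
Proof. by rewrite gmonoW ?in_itv/= ?lexx ?(ltW uv). Qed.

(** Intersecting []a, b]] with [J] clamps its endpoints, and clamped endpoints are values of g on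
    [u, v]. *)
Let clamp (y : R) := Num.max g.[u] (Num.min y g.[v]).

Let clamp_preimage y : exists2 s, u <= s <= v & g.[s] = clamp y.
Proof.
have cy : g.[u] <= clamp y <= g.[v].
  by rewrite /clamp le_max lexx/= ge_max gle/= ge_min lexx orbT.
have [|s suv] := @poly_ivt R (g - (clamp y)%:P) u v (ltW uv).
  rewrite !hornerD !hornerN !hornerC; case/andP: cy => c1 c2.
  by rewrite subr_le0 subr_ge0 c1.
rewrite rootE !hornerE subr_eq0 => /eqP gs.
by exists s.
Qed.

(** The image under g of the measure with density g' on []u, v]], completed by the Lebesgue measure
    outside [J], agrees with the Lebesgue measure on half-open intervals, hence on all measurable
    sets. Restricting to [J] removes the completion. *)
Lemma area_monotone B : measurable B ->
  leb (B `&` J) = (\int[leb]_(x in `]u, v]%classic `&` (horner g @^-1` B)) `|(g^`()).[x]|%:E)%E.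
Proof.
have main B' : measurable B' -> leb B' = (push B' + rest B')%E.
  move=> mB'; transitivity (measure_add push rest B'); last exact: measure_addE.
  apply: (@lebesgue_measure_unique R (measure_add push rest)) => // _ [[a b]] _ <-.
  rewrite [RHS]measure_addE /rest /= /mrestr.
  set I : set RT := `]a, b]%classic.
  have mI : measurable I by exact: measurable_itv.
  have -> : leb I = (leb (I `&` J) + leb (I `&` ~` J))%E.
    by rewrite -setDE addeC; exact: measureDI.
  congr (_ + _)%E.
  have [ba|ab] := leP b a.
    have -> : I = set0 by rewrite /I set_itv_ge// bnd_simp -leNgt.
    by rewrite set0I measure0 -[RHS]/(push set0) measure0.
  have [s /andP[us sv] gs] := clamp_preimage a.
  have [t /andP[ut tv] gt] := clamp_preimage b.
  have suv : s \in `[u, v] by rewrite in_itv/= us sv.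
  have tuv : t \in `[u, v] by rewrite in_itv/= ut tv.
  have cab : clamp a <= clamp b.
    rewrite /clamp ge_max le_max lexx/= le_max; apply/orP; right.
    by rewrite le_min !ge_min (ltW ab) lexx orbT.
  have st : s <= t by rewrite -(gmonoW suv tuv) gs gt.
  have clampE y : g.[u] < y <= g.[v] -> (clamp a < y <= clamp b) = (a < y <= b).
    move=> /andP[uy yv]; rewrite /clamp gt_max gt_min uy/= le_max le_min yv andbT.
    rewrite [y <= g.[u]]leNgt uy/=; congr (_ && _).
    by rewrite [g.[v] < y]ltNge yv orbF.
  have -> : I `&` J = `]clamp a, clamp b]%classic.
    apply/seteqP; split => y /=; rewrite !in_itv/=.
      by move=> [aby uvy]; rewrite clampE.
    move=> cy; have uvy : g.[u] < y <= g.[v].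
      case/andP: cy => c1 c2; apply/andP; split.
        by apply: le_lt_trans c1; rewrite /clamp le_max lexx.
      by apply: (le_trans c2); rewrite /clamp ge_max gle/= ge_min lexx orbT.
    by split; rewrite // /I/= in_itv/= -clampE.
  rewrite lebesgue_measure_itv/= lte_fin.
  transitivity ((clamp b - clamp a)%:E : \bar R).
    have [//|ba] := ltP (clamp a) (clamp b).
    by have -> : clamp a = clamp b by [apply/eqP; rewrite eq_le cab ba]; rewrite subrr.
  rewrite -gs -gt -integral_density_itv// /pushforward /nu /density_measure /=.
  rewrite [LHS]integral_mkcond [RHS]integral_mkcond; apply: eq_integral => x _.
  have [xuv|xuv] := boolP (u < x <= v); last first.
    by rewrite /patch h_out// !if_same.
  have xuv' : x \in `[u, v] by move: xuv; rewrite in_itv/= => /andP[/ltW->].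
  have uu : u \in `[u, v] by rewrite in_itv/= lexx (ltW uv).
  have vv : v \in `[u, v] by rewrite in_itv/= lexx (ltW uv).
  have e1 : (x \in (horner g @^-1` I)) = (a < g.[x] <= b).
    apply/idP/idP => [/set_mem|xab]; first by rewrite /I/= in_itv.
    by apply/mem_set; rewrite /I/= in_itv.
  have e2 : (x \in (`]s, t]%classic : set RT)) = (s < x <= t).
    by rewrite mem_setE in_itv.
  rewrite /patch e1 e2 -(gmono suv xuv') -(gmonoW xuv' tuv) gs gt clampE//.
  by rewrite (gmono uu xuv') (gmonoW xuv' vv).
move=> mB; have mBJ : measurable (B `&` J) by exact: measurableI.
rewrite main// /rest /= /mrestr -setIA setICr setI0 measure0 adde0.
rewrite /push /= /pushforward /nu /density_measure /=.
rewrite [LHS]integral_mkcond [RHS]integral_mkcond; apply: eq_integral => x _.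
have uu : u \in `[u, v] by rewrite in_itv/= lexx (ltW uv).
have vv : v \in `[u, v] by rewrite in_itv/= lexx (ltW uv).
have [xuv|xuv] := boolP (u < x <= v); last first.
  rewrite /patch h_out// if_same memNset// => -[].
  by rewrite /= in_itv/= (negbTE xuv).
have xuv' : x \in `[u, v] by move: xuv; rewrite in_itv/= => /andP[/ltW->].
have Jx : J g.[x] by rewrite /J/= in_itv/= (gmono uu xuv') (gmonoW xuv' vv).
have g'x : 0 <= (g^`()).[x].
  case/andP: xuv => ux; rewrite le_eqVlt => /predU1P[->|xv]; last first.
    by rewrite ltW// gpos// in_itv/= ux.
  (* At the endpoint v a negative derivative would, by the intermediate value theorem, vanish at
     some point inside the interval. *)
  rewrite leNgt; apply/negP => g'v; have uv' := uv.
  have muv : (u + v) / 2 \in `]u, v[ by rewrite in_itv/=; apply/andP; split; lra.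
  have mv : (u + v) / 2 <= v by lra.
  have [|y] := poly_ivtoo mv (p := g^`()); first by rewrite pmulr_rlt0// gpos.
  rewrite in_itv/= => /andP[y1 y2] /rootP ry.
  have : 0 < (g^`()).[y] by rewrite gpos// in_itv/= y2 andbT; lra.
  by rewrite ry ltxx.
rewrite /patch h_in// max_r// ger0_norm//.
have xJ : (`]u, v]%classic : set R) x by rewrite /= in_itv.
by congr (if _ then _ else _); apply/idP/idP; rewrite !inE/= => -[].
Qed.

End Monotone.
End AreaFormula.

(** * From monotone pieces to arbitrary polynomials *)

Section PolynomialAreaFormula.
Variable R : realType.
Local Notation RT := (measurableTypeR R).
Local Notation leb := (@lebesgue_measure R).
Implicit Types (g : {poly R}) (u v : R) (B : set RT).

Definition horner_image g u v : set RT := [set y | exists2 x, u < x <= v & g.[x] = y].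

Lemma subr_polyC_neq0 g (y : R) : (1 < size g)%N -> g - y%:P != 0.
Proof.
move=> g1; rewrite subr_eq0; apply/eqP => gy.
by move: g1; rewrite gy ltnNge size_polyC_leq1.
Qed.

Lemma root_subC g (x y : R) : root (g - y%:P) x = (g.[x] == y).
Proof. by rewrite rootE !hornerE subr_eq0. Qed.

Lemma root_count_image g u v (y : R) : (1 < size g)%N ->
  {in `]u, v] &, injective (horner g)} ->
  (root_count (g - y%:P) u v)%:R = \1_(horner_image g u v) y :> R.
Proof.
move=> g1 inj; have p0 := @subr_polyC_neq0 g y g1.
rewrite indicE; have [[x xuv gx]|ny] := pselect (horner_image g u v y).
  rewrite mem_set; last by exists x.
  rewrite (@root_count_eq1 _ _ _ _ x)// ?root_subC ?gx// => z zuv.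
  by rewrite root_subC -gx => /eqP; apply: inj; rewrite in_itv.
rewrite memNset// root_count0// => z zuv; rewrite root_subC; apply/eqP => gz.
by apply: ny; exists z.
Qed.

Lemma horner_image_incr g u v : u < v ->
  (forall x, x \in `]u, v[ -> 0 < (g^`()).[x]) ->
  horner_image g u v = `]g.[u], g.[v]]%classic.
Proof.
move=> uv gpos; have lt := ltr_horner gpos; have le := ler_horner gpos.
have uu : u \in `[u, v] by rewrite in_itv/= lexx (ltW uv).
have vv : v \in `[u, v] by rewrite in_itv/= lexx (ltW uv).
apply/seteqP; split => y /=; rewrite in_itv/=.
  move=> [x xuv <-]; have xx : x \in `[u, v].
    by rewrite in_itv/=; case/andP: xuv => /ltW->.
  by rewrite lt// le.
move=> /andP[uy yv].
have [|x /[!in_itv]/= xuv] := @polyrcf.poly_ivt R (g - y%:P) u v (ltW uv).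
  rewrite !hornerD !hornerN !hornerC.
  by rewrite mulr_le0_ge0 ?subr_le0 ?subr_ge0 ?(ltW uy).
rewrite root_subC => /eqP gx; exists x => //.
have xx : x \in `[u, v] by rewrite in_itv.
by rewrite -(lt u x uu xx) gx uy; case/andP: xuv.
Qed.

(** A derivative without roots has constant sign; the decreasing case is the increasing one for - g,
    with B and the image reflected. *)
Lemma area_monotone_image g u v B : u < v -> measurable B ->
  (forall x, x \in `]u, v[ -> ~~ root g^`() x) ->
  [/\ {in `]u, v] &, injective (horner g)}, measurable (horner_image g u v) &
  leb (B `&` horner_image g u v) =
    (\int[leb]_(x in `]u, v]%classic `&` (horner g @^-1` B)) `|(g^`()).[x]|%:E)%E].
Proof.
move=> uv mB gN0.
have sub x : x \in `]u, v] -> x \in `[u, v].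
  by rewrite !in_itv/= => /andP[/ltW-> ->].
have muv : (u + v) / 2 \in `]u, v[ by rewrite in_itv/=; apply/andP; split; lra.
have sg x : x \in `]u, v[ -> Num.sg g^`().[x] = Num.sg g^`().[(u + v) / 2].
  by move=> xuv; apply: (polyrN0_itv _ muv xuv) => y; exact: gN0.
case: (sgrP g^`().[(u + v) / 2]) (sg) => [g0|gpos|gneg] {}sg.
- by have := gN0 _ muv; rewrite rootE g0 eqxx.
- have gpos' x : x \in `]u, v[ -> 0 < (g^`()).[x].
    by move=> /sg/eqP; rewrite sgr_cp0.
  split.
  + by move=> x y /sub xuv /sub yuv; apply: (derp_inj gpos').
  + by rewrite horner_image_incr//; exact: measurable_itv.
  + by rewrite horner_image_incr//; exact: area_monotone.
- have gpos' x : x \in `]u, v[ -> 0 < ((- g)^`()).[x].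
    by move=> /sg/eqP; rewrite sgr_cp0 derivN hornerN oppr_gt0.
  have imN : horner_image g u v = (-%R : RT -> RT) @^-1` (horner_image (- g) u v).
    apply/seteqP; split => y /= [x xuv]; rewrite ?hornerN => gx; exists x => //.
      by rewrite hornerN gx.
    exact: oppr_inj gx.
  have mN : measurable_fun [set: RT] (-%R : RT -> RT).
    exact: oppr_measurable.
  have mpre A : measurable A -> measurable ((-%R : RT -> RT) @^-1` A).
    by move=> mA; rewrite -[X in measurable X]setTI; exact: mN.
  have mim : measurable (horner_image (- g) u v).
    by rewrite horner_image_incr//; exact: measurable_itv.
  split.
  + move=> x y /sub xuv /sub yuv gxy; apply: (derp_inj gpos' xuv yuv).
    by rewrite !hornerN gxy.
  + by rewrite imN; exact: mpre.
  + have -> : B `&` horner_image g u v = (-%R : RT -> RT) @^-1`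
        (((-%R : RT -> RT) @^-1` B) `&` horner_image (- g) u v).
      by rewrite imN; apply/seteqP; split => y /=; rewrite opprK.
    have := @lebesgue_measureN R (((-%R : RT -> RT) @^-1` B) `&` horner_image (- g) u v).
    rewrite /pushforward => ->; last by apply: measurableI => //; exact: mpre.
    rewrite [in LHS]horner_image_incr// area_monotone//; last exact: mpre.
    rewrite derivN.
    have -> : horner (- g) @^-1` ((-%R : RT -> RT) @^-1` B) = horner g @^-1` B.
      by apply/seteqP; split => x /=; rewrite hornerN opprK.
    by apply: eq_integral => x _; rewrite hornerN normrN.
Qed.

(** Induction on the number of critical points inside the interval, cutting at one of them.
    Measurability of the count is proved along with the formula because adding the integrals of the
    two halves needs it. *)
Lemma area_formula g u v B : (1 < size g)%N -> u <= v -> measurable B ->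
  measurable_fun [set: RT] (fun y : RT => (root_count (g - y%:P) u v)%:R : RT) /\
  (\int[leb]_y (\1_B y * (root_count (g - y%:P) u v)%:R)%:E =
   \int[leb]_(x in `]u, v]%classic `&` (horner g @^-1` B)) `|(g^`()).[x]|%:E)%E.
Proof.
move=> g1 + mB.
have g'0 : g^`() != 0.
  apply/eqP => /(congr1 (fun q : {poly R} => q`_(size g).-2)).
  rewrite coef_deriv coef0; case sg : (size g) g1 => [|[|m]]//= _.
  have := lead_coef_eq0 g; rewrite /lead_coef sg/= -size_poly_eq0 sg => /negbT gm.
  by move=> /eqP; rewrite mulrn_eq0/= (negbTE gm).
have [n] := ubnP (count (fun x => u < x < v) (rootsR g^`())).
elim: n u v => // n IH u v; rewrite ltnS => cn.
rewrite le_eqVlt => /predU1P[->|uv].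
  have z y : root_count (g - y%:P) v v = 0%N.
    apply: root_count0 => [|x]; first exact: subr_polyC_neq0.
    by move=> /andP[vx xv]; have := lt_le_trans vx xv; rewrite ltxx.
  split; first by under eq_fun do rewrite z; exact: measurable_cst.
  rewrite set_itv_ge ?bnd_simp// set0I integral_set0.
  by rewrite integral0_eq// => y _; rewrite z mulr0.
have [/hasP[w]|/hasPn noroot] := boolP (has (fun x => u < x < v) (rootsR g^`())).
  rewrite mem_rootsR// => rw /andP[uw wv].
  (* Both open halves exclude the cut point w, which is itself a critical point, so each contains
     strictly fewer of them. *)
  have cw (P : pred R) : (forall x, P x -> u < x < v) -> ~~ P w ->
      (count P (rootsR g^`()) < n)%N.
    move=> Puv Pw; apply: leq_trans cn.
    have -> : count (fun x => u < x < v) (rootsR g^`()) =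
      (count P (rootsR g^`()) + count (fun x => (u < x < v)%R && ~~ P x) (rootsR g^`()))%N.
      rewrite -[RHS]count_predUI.
      rewrite [X in (_ + X)%N](_ : _ = 0%N); last first.
        apply/eqP; rewrite -leqn0 leqNgt -has_count; apply/hasPn => x _ /=.
        by case: (P x); rewrite ?andbF.
      rewrite addn0; apply: eq_count => x /=.
      by case Px : (P x); rewrite ?andbT //= Puv.
    rewrite -[X in (X < _)%N]addn0 ltn_add2l -has_count; apply/hasP; exists w.
      by rewrite mem_rootsR.
    by rewrite uw wv.
  have [|m1 e1] := IH u w _ (ltW uw).
    apply: cw; last by rewrite ltxx andbF.
    by move=> x /andP[-> xw]; exact: lt_trans wv.
  have [|m2 e2] := IH w v _ (ltW wv).
    apply: cw; last by rewrite ltxx.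
    by move=> x /andP[wx ->]; rewrite (lt_trans uw).
  have splitE y : (root_count (g - y%:P) u v)%:R =
     (root_count (g - y%:P) u w)%:R + (root_count (g - y%:P) w v)%:R :> R.
    by rewrite -natrD -root_count_split// (ltW uw) (ltW wv).
  split.
    by under eq_fun do rewrite splitE; exact: measurable_funD.
  under eq_integral do rewrite splitE mulrDr EFinD.
  rewrite ge0_integralD//; first last.
  - by apply/measurable_EFinP; apply: measurable_funM => //; exact: measurable_indic.
  - by apply/measurable_EFinP; apply: measurable_funM => //; exact: measurable_indic.
  rewrite e1 e2 -ge0_integral_setU//; first last.
  - apply/disj_setPRL => x /= [+ _] [+ _]; rewrite !in_itv/= => /andP[wx _] /andP[_ xw].
    by have := lt_le_trans wx xw; rewrite ltxx.
  - apply/measurable_EFinP; apply: measurable_funTS; apply: measurableT_comp => //.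
    exact: measurable_horner.
  - apply: measurableI; [exact: measurable_itv|exact: measurable_horner_preimage].
  - apply: measurableI; [exact: measurable_itv|exact: measurable_horner_preimage].
  congr (\int[_]_(x in _) _)%E; rewrite -setIUl; congr (_ `&` _).
  apply/seteqP; split => x /=; rewrite !in_itv/=.
    move=> [/andP[-> xw]|/andP[wx ->]]; first by rewrite (le_trans xw (ltW wv)).
    by rewrite (lt_trans uw wx).
  by move=> /andP[-> ->]; rewrite andbT /=; case: (leP x w); [left|right].
have noroot' x : x \in `]u, v[ -> ~~ root g^`() x.
  rewrite in_itv/= => xuv; apply/negP => rx.
  by have := noroot x; rewrite mem_rootsR// => /(_ rx); rewrite xuv.
have [inj mim e] := area_monotone_image uv mB noroot'.
split.
  under eq_fun do rewrite root_count_image//.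
  exact: measurable_indic.
rewrite -e -[B `&` _]setIT -integral_indic//; last exact: measurableI.
by apply: eq_integral => y _; rewrite root_count_image// indicI.
Qed.

End PolynomialAreaFormula.

(** * The expected number of real zeros *)

Section RootCountMeasurable.
Variable R : realType.
Local Notation RT := (measurableTypeR R).
Implicit Types (u v : R).

(** By compactness |p| attains its minimum on [u, v], and by continuity rational points suffice to
    see that this minimum is 0. The right-hand side involves countably many values only. *)
Lemma poly_root_itvP (p : {poly R}) u v : u < v ->
  (exists2 x, u <= x <= v & root p x) <->
  forall k : nat, exists2 q : rat, u <= ratr q <= v & `|p.[ratr q]| < k.+1%:R^-1.
Proof.
move=> uv; split=> [[x xuv rx] k|H].
  have e0 : 0 < k.+1%:R^-1 :> R by rewrite invr_gt0.
  have [d d0 dp] := poly_cont x p e0.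
  have [q] : exists q, ratr q \in `]Num.max u (x - d), (Num.min v (x + d))[.
    apply: rat_in_itvoo; rewrite gt_max !lt_min uv /=; case/andP: xuv => ? ?.
    by apply/andP; split; [|apply/andP; split]; lra.
  rewrite in_itv/= gt_max lt_min => /andP[/andP[q1 q2] /andP[q3 q4]].
  exists q; first by rewrite !ltW.
  have := dp (ratr q); rewrite (rootP rx) subr0; apply.
  by rewrite ltr_norml; apply/andP; split; lra.
have cp : {within `[u, v], continuous (fun x => `|p.[x]| : R^o)}.
  apply: continuous_subspaceT => x.
  by apply: continuous_comp; [exact: continuous_horner|exact: norm_continuous].
have [c cuv cmin] := @EVT_min R (fun x => `|p.[x]|) u v (ltW uv) cp.
exists c; first by move: cuv; rewrite in_itv.
rewrite rootE -normr_le0 leNgt; apply/negP => pc0.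
have [k kp] : exists k : nat, k.+1%:R^-1 < `|p.[c]|.
  exists (Num.truncn `|p.[c]|^-1).
  by rewrite invf_plt ?posrE// truncnS_gt.
have [q quv] := H k; apply/negP; rewrite -leNgt (le_trans (ltW kp))//.
by apply: cmin; rewrite in_itv.
Qed.

Lemma measurable_root_itv n u v : u < v ->
  measurable [set a : n.-tuple RT | exists2 x, u <= x <= v & root (monic_poly a) x].
Proof.
move=> uv.
pose F (k : nat) (q : rat) : set (n.-tuple RT) :=
  if u <= ratr q <= v then [set a : n.-tuple RT | `|(monic_poly a).[ratr q]| < k.+1%:R^-1]
  else set0.
rewrite (_ : [set _ | _] = \bigcap_k \bigcup_q F k q).
  apply: bigcapT_measurable => k; apply: bigcupT_measurable_rat => q.
  rewrite /F; case: ifP => // _; rewrite -[X in measurable X]setTI.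
  apply: (@measurable_fun_ltr _ _ _ _ (fun a : n.-tuple RT => `|(monic_poly a).[ratr q]| : RT)
    (fun=> k.+1%:R^-1 : RT)) => //.
  apply: measurableT_comp => //; apply: measurable_fun_horner_monic => //.
apply/seteqP; split => a /=.
  move=> /(poly_root_itvP _ uv) H k _; have [q quv qa] := H k.
  by exists q => //; rewrite /F quv.
move=> H; apply/(poly_root_itvP _ uv) => k; have [q _] := H k I.
by rewrite /F; case: ifP => // quv qa; exists q.
Qed.

Lemma uniq_separated (s : seq R) : uniq s ->
  exists2 d : R, 0 < d & {in s &, forall x y, x != y -> d <= `|x - y|}.
Proof.
elim: s => [|x s IH] /=; first by exists 1.
move=> /andP[xs /IH [d d0 sd]].
have [e e0 se] : exists2 e : R, 0 < e & {in s, forall y, e <= `|x - y|}.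
  elim: s xs {IH sd} => [|y s IH]; first by exists 1.
  rewrite inE negb_or => /andP[xy /IH [e e0 se]].
  exists (Num.min e `|x - y|); first by rewrite lt_min e0 normr_gt0 subr_eq0.
  by move=> z; rewrite inE => /predU1P[->|/se]; rewrite ge_min ?lexx ?orbT// => ->.
exists (Num.min d e); first by rewrite lt_min d0.
move=> y z; rewrite !inE => /predU1P[->|ys] /predU1P[->|zs] yz.
- by rewrite eqxx in yz.
- by rewrite ge_min se ?orbT.
- by rewrite ge_min distrC se ?orbT.
- by rewrite ge_min sd.
Qed.

Lemma size_rootsR_geP (p : {poly R}) (r : nat) : p != 0 ->
  (r < size (rootsR p))%N <->
  exists ms : nat * seq int, [/\ size ms.2 = r.+1, uniq ms.2,
    {in ms.2 &, forall i j : int, i != j -> 2 <= `|i - j|} &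
    {in ms.2, forall i : int, exists2 x,
      i%:~R / ms.1.+1%:R <= x <= (i%:~R + 1) / ms.1.+1%:R & root p x}].
Proof.
move=> p0; split=> [rs|[[m s] /= [sr us sep hs]]].
  have [d d0 sd] := uniq_separated (uniq_rootsR p).
  (* The mesh is less than half the minimal distance of two roots, so the cell indices of distinct
     roots differ by more than 1. *)
  pose m := Num.truncn (2 / d).
  have m0 : 0 < m.+1%:R :> R by rewrite ltr0n.
  have md : 2 < d * m.+1%:R by rewrite -ltr_pdivrMl// mulrC truncnS_gt.
  pose fl (x : R) := Num.floor (x * m.+1%:R).
  have flb (x : R) : (fl x)%:~R <= x * m.+1%:R < (fl x)%:~R + 1.
    by have := floor_itv (x * m.+1%:R); rewrite intrD.
  have sep : {in rootsR p &, forall x y, x != y -> 2 <= `|fl x - fl y|}.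
    move=> x y xr yr xy; have := sd x y xr yr xy.
    rewrite -(ler_pM2r m0) => dxy.
    have : 2 < `|x * m.+1%:R - y * m.+1%:R|.
      by rewrite -mulrBl normrM [`|m.+1%:R|]gtr0_norm//; apply: lt_le_trans dxy.
    case/andP: (flb x) => a1 a2; case/andP: (flb y) => b1 b2 h.
    have : 1 < `|(fl x)%:~R - (fl y)%:~R| :> R.
      by move: h; rewrite !ltr_normr => /orP[] h; apply/orP; [left|right]; lra.
    rewrite -intrB -intr_norm -(mulr1z (1 : R)) ltr_int.
    by case: (`|fl x - fl y|).
  have inj : {in rootsR p &, injective fl}.
    move=> x y xr yr xy; apply/eqP/negPn/negP => /(sep _ _ xr yr).
    by rewrite xy subrr normr0.
  exists (m, map fl (take r.+1 (rootsR p))); split => /=.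
  - by rewrite size_map size_takel.
  - rewrite map_inj_in_uniq; first by rewrite take_uniq// uniq_rootsR.
    by move=> x y /mem_take xr /mem_take yr; exact: inj.
  - move=> i j /mapP[x /mem_take xr ->] /mapP[y /mem_take yr ->] ij.
    by apply: sep => //; apply: contraNneq ij => ->.
  - move=> i /mapP[x /mem_take xr ->]; exists x; last by rewrite -mem_rootsR.
    by case/andP: (flb x) => a1 a2; rewrite ler_pdivrMr// ler_pdivlMr// a1 ltW.
have m0 : 0 < m.+1%:R :> R by rewrite ltr0n.
have /choice [c hc] : forall i : int, exists x : R, i \in s ->
    i%:~R / m.+1%:R <= x <= (i%:~R + 1) / m.+1%:R /\ root p x.
  move=> i; have [/hs [x xi rx]|_] := boolP (i \in s); first by exists x.
  by exists 0.
rewrite -sr -(size_map c); apply: uniq_leq_size.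
  rewrite map_inj_in_uniq// => i j /[dup] si /hc [ci _] /[dup] sj /hc [cj _] cij.
  apply/eqP/negPn/negP => /(sep _ _ si sj).
  move: ci cj; rewrite cij !ler_pdivrMr// !ler_pdivlMr// => /andP[i1 i2] /andP[j1 j2].
  have : `|i%:~R - j%:~R| <= 1 :> R by rewrite ler_norml; apply/andP; split; lra.
  rewrite -intrB -intr_norm -(mulr1z (1 : R)) ler_int.
  by case: (`|i - j|) => [[|[|k]]|k].
by move=> _ /mapP[i /hc [_ rc] ->]; rewrite mem_rootsR.
Qed.

Lemma size_rootsR_monic n (a : n.-tuple R) : (size (rootsR (monic_poly a)) <= n)%N.
Proof.
have [sa ma] := monic_poly_size a; have a0 := monic_neq0 ma.
rewrite -ltnS -sa; apply: max_poly_roots => //; last exact: uniq_rootsR.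
by apply/allP => x; rewrite mem_rootsR.
Qed.

Lemma measurable_size_rootsR n :
  measurable_fun [set: n.-tuple RT] (fun a => (size (rootsR (monic_poly a)))%:R : RT).
Proof.
pose A r : set (n.-tuple RT) := [set a | (r < size (rootsR (monic_poly a)))%N].
have mA r : measurable (A r).
  pose F (ms : nat * seq int) : set (n.-tuple RT) :=
    if `[< [/\ size ms.2 = r.+1, uniq ms.2 &
      {in ms.2 &, forall i j : int, i != j -> 2 <= `|i - j|}] >]
    then [set a : n.-tuple RT | {in ms.2, forall i : int, exists2 x,
      i%:~R / ms.1.+1%:R <= x <= (i%:~R + 1) / ms.1.+1%:R & root (monic_poly a) x}]
    else set0.
  rewrite (_ : A r = \bigcup_ms F ms).
    apply: countable_bigcupT_measurable => [|[m s]]; first exact: countableP.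
    rewrite /F; case: ifP => // _ /=.
    elim: s => [|i s IH]; first by rewrite (_ : [set _ | _] = setT)//; apply/seteqP; split.
    have m0 : 0 < m.+1%:R :> R by rewrite ltr0n.
    rewrite (_ : [set _ | _] = [set a : n.-tuple RT | exists2 x,
      i%:~R / m.+1%:R <= x <= (i%:~R + 1) / m.+1%:R & root (monic_poly a) x] `&`
      [set a : n.-tuple RT | {in s, forall i : int, exists2 x,
      i%:~R / m.+1%:R <= x <= (i%:~R + 1) / m.+1%:R & root (monic_poly a) x}]).
      apply: measurableI => //; apply: measurable_root_itv.
      by rewrite ltr_pM2r ?invr_gt0//; lra.
    apply/seteqP; split => a /= h.
      by split; [apply: h; rewrite mem_head|move=> j js; apply: h; rewrite inE js orbT].
    by case: h => h1 h2 j; rewrite inE => /predU1P[->|/h2].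
  apply/seteqP; split => a; rewrite /A /=; have ma := monic_neq0 (monic_poly_size a).2.
    move=> /(size_rootsR_geP _ ma) [ms [h1 h2 h3 h4]]; exists ms => //.
    by rewrite /F; case: ifPn => [_|/asboolPn[]].
  move=> [ms _]; rewrite /F; case: ifPn => // /asboolP [h1 h2 h3] h4.
  by apply/(size_rootsR_geP _ ma); exists ms.
rewrite (_ : (fun _ => _) = (fun a => \sum_(r < n) \1_(A r) a)).
  by apply: measurable_sum => r; exact: measurable_indic.
apply/funext => a; have := size_rootsR_monic a.
set N := size _ => Nn.
have -> : N = (\sum_(r < n) (r < N)%N)%N.
  suff -> : (\sum_(r < n) (r < N)%N = minn n N)%N by lia.
  elim: (n) => [|k IH]; first by rewrite big_ord0 min0n.
  by rewrite big_ord_recr/= IH; lia.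
rewrite natr_sum; apply: eq_bigr => r _.
by rewrite indicE; congr (_%:R); congr nat_of_bool; apply/idP/idP; rewrite inE.
Qed.

End RootCountMeasurable.

(** * Integrating the number of roots along lines of constant terms *)

Section Expectation.
Variable R : realType.
Local Notation RT := (measurableTypeR R).
Local Notation leb := (@lebesgue_measure R).
Local Notation lebt := (lebesgue_tuple R).

Lemma synthetic_div_cons n x q a (t : n.-tuple R) :
  synthetic_div x q [tuple of a :: t] =
  [tuple of (a + x * q) :: synthetic_div x (a + x * q) t].
Proof. exact/val_inj. Qed.

(** Each coefficient is translated by x times the preceding output, so translation invariance
    applies one coordinate at a time. The initial value q is arbitrary because the tail starts from
    the output a + x q. *)
Lemma integral_synthetic_div n (x q : R) (f : n.-tuple RT -> \bar R) :
  measurable_fun [set: n.-tuple RT] f -> (forall t, 0 <= f t)%E ->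
  (\int[lebt n]_t f (synthetic_div x q t) = \int[lebt n]_t f t)%E.
Proof.
have ms k (r : R) : measurable_fun [set: k.-tuple RT]
    (synthetic_div x r : k.-tuple RT -> k.-tuple RT).
  by apply: (@measurable_fun_synthetic_div R _ _ k (fun=> x) (fun=> r) id).
elim: n q f => [|n IH] q f mf f0.
  by apply: eq_integral => t _; rewrite !(tuple0 (synthetic_div _ _ _)) (tuple0 t).
have mfs := measurableT_comp mf (ms n.+1 q).
etransitivity; first exact: (integral_tuple_cons mfs (fun t => f0 _)).
apply/esym; etransitivity; first exact: (integral_tuple_cons mf f0).
apply/esym => /=.
rewrite [RHS](integral_affine (x * q) ltr01); last 2 first.
- apply: measurable_fun_integral_snd => [|a t]; last exact: f0.
  exact: measurableT_comp mf (@measurable_tuple_cons R n).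
- by move=> a; apply: integral_ge0 => t _; exact: f0.
rewrite mul1e; apply: eq_integral => a _; rewrite mul1r.
under eq_integral do rewrite synthetic_div_cons.
apply: (IH _ (fun t => f [tuple of (a + x * q) :: t])) => [|t]; last exact: f0.
by apply: (measurableT_comp mf); exact: measurable_fun_tuple_cons.
Qed.

Lemma root_countN (p : {poly R}) u v : p != 0 -> root_count (- p) u v = root_count p u v.
Proof.
move=> p0; apply/permP; apply: uniq_perm; rewrite ?uniq_rootsR// => x.
by rewrite !mem_rootsR ?oppr_eq0// rootN.
Qed.

Lemma fiber_integral n (a : n.-tuple R) :
  (\int[leb]_c (\1_(@Omega R n.+1) [tuple of rcons a c] *
      (size (rootsR (monic_poly [tuple of rcons a c])))%:R)%:E =
   \int[leb]_x (\1_(`[(-1)%R, 1%R]%classic : set R) x *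
      (\1_(@Omega R n) (synthetic_div x 1 a) *
       `|(monic_poly (synthetic_div x 1 a)).[x]|))%:E)%E.
Proof.
pose g := - (monic_poly a * 'X).
have [sa ma] := monic_poly_size a.
have g1 : (1 < size g)%N by rewrite size_polyN size_mulX ?monic_neq0// sa.
pose B : set RT := [set c | Omega [tuple of rcons a c]].
have mB : measurable B.
  rewrite -[B]setTI; apply: (measurable_fun_tuple_rcons _ _) => //.
  exact: measurable_Omega.
have gc c : monic_poly [tuple of rcons a c] = - (g - c%:P).
  by rewrite monic_poly_rcons /g opprB opprK addrC.
have g' x : (g^`()).[x] = - (monic_poly (synthetic_div x 1 a)).[x].
  rewrite /g derivN hornerN; congr (- _).
  transitivity ((monic_poly a * 'X - (x * (monic_poly a).[x])%:P)^`().[x]).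
    by rewrite derivB derivC subr0.
  by rewrite synthetic_divP derivM derivXsubC mul1r !hornerE subrr mul0r addr0.
(* The area formula counts roots in half-open intervals; starting at -2 includes the possible root
   -1. *)
have N12 : (- 2 : R) <= 1 by lra.
have [_ area] := area_formula g1 N12 mB.
transitivity (\int[leb]_y (\1_B y * (root_count (g - y%:P) (-2) 1)%:R)%:E)%E.
  apply: eq_integral => c _; congr EFin.
  have -> : \1_(@Omega R n.+1) [tuple of rcons a c] = \1_B c :> R.
    by rewrite !indicE; congr (_%:R); congr nat_of_bool; apply/idP/idP; rewrite !inE.
  have [cB|cB] := pselect (B c); last by rewrite indicE memNset// !mul0r.
  congr (_ * _%:R); rewrite -root_countN ?subr_polyC_neq0// -gc /root_count.
  rewrite -[LHS]count_predT; apply: eq_in_count => x.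
  rewrite mem_rootsR ?monic_neq0 ?(monic_poly_size _).2// => /(disk_roots_real_root cB).
  rewrite ler_norml => /andP[x1 x2]; have x3 : - 2 < x by lra.
  by rewrite x2 x3.
rewrite {}area integral_mkcond; apply: eq_integral => x _.
rewrite /patch g' normrN.
have gx : [tuple of rcons a g.[x]] = [tuple of rcons a (- (x * (monic_poly a).[x]))].
  by congr [tuple of rcons _ _]; rewrite /g hornerN hornerMX mulrC.
have OB : B g.[x] <-> `|x| <= 1 /\ Omega (synthetic_div x 1 a).
  rewrite /B /= gx /Omega /= monic_poly_rcons_root.
  apply: (iff_trans (disk_rootsM _ _)); split=> [[/disk_roots_XsubC]|[x1]] //.
  by split => //; apply/disk_roots_XsubC.
case: ifPn => [/set_mem [x1 /OB [x2 xO]]|].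
  rewrite !indicE (mem_set xO) mem_set ?mul1r//=.
  by rewrite in_itv/= -ler_norml.
move=> nx; rewrite !indicE.
have [x1|x1] := boolP (`|x| <= 1); last first.
  by rewrite memNset ?mul0r//= in_itv/= -ler_norml; exact/negP.
have [xO|xO] := pselect (Omega (synthetic_div x 1 a)); last first.
  by rewrite (memNset xO) mul0r mulr0.
move: nx; rewrite mem_set//; split; last by apply/OB.
by rewrite /= in_itv/=; move: x1; rewrite ler_norml => /andP[h ->]; rewrite andbT; lra.
Qed.

Lemma integral_size_rootsR n :
  (\int[lebt n.+1]_(a in @Omega R n.+1) (size (rootsR (monic_poly a)))%:R%:E =
   \int[leb]_(x in `[(-1 : R)%R, 1%R])
     \int[lebt n]_(a in @Omega R n) `|(monic_poly a).[x]|%:E)%E.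
Proof.
have mO k := @measurable_Omega R k.
have restr k (f : k.-tuple RT -> R) :
    (\int[lebt k]_(a in @Omega R k) (f a)%:E =
     \int[lebt k]_a (\1_(@Omega R k) a * f a)%:E)%E.
  rewrite integral_mkcond; apply: eq_integral => a _.
  by rewrite /patch indicE; case: ifP => _; rewrite ?mul1r ?mul0r.
rewrite restr integral_tuple_rcons; last 2 first.
- apply/measurable_EFinP; apply: measurable_funM.
    by apply: measurable_indic; exact: mO.
  exact: measurable_size_rootsR.
- by move=> a; rewrite lee_fin mulr_ge0.
under eq_integral do rewrite fiber_integral.
pose f (x : RT) (a : n.-tuple RT) : R :=
  \1_(@Omega R n) a * `|(monic_poly a).[x]|.
have mf d (T : measurableType d) (h : T -> RT) (k : T -> n.-tuple RT) :
    measurable_fun [set: T] h -> measurable_fun [set: T] k ->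
    measurable_fun [set: T] (fun p => f (h p) (k p) : RT).
  move=> mh mk; apply: measurable_funM.
    by apply: (measurableT_comp _ mk); apply: measurable_indic; exact: mO.
  by apply: measurableT_comp => //; exact: measurable_fun_horner_monic.
have f0 x a : 0 <= f x a by rewrite mulr_ge0.
have mI : measurable_fun [set: RT] (\1_(`[(-1 : R)%R, 1%R]%classic : set RT) : RT -> RT).
  by apply: measurable_indic; exact: measurable_itv.
have ms2 : measurable_fun [set: n.-tuple RT * RT] (snd : n.-tuple RT * RT -> RT).
  exact: measurable_snd.
have ms1 : measurable_fun [set: n.-tuple RT * RT] (fst : n.-tuple RT * RT -> n.-tuple RT).
  exact: measurable_fst.
have msd : measurable_fun [set: n.-tuple RT * RT]
    (fun p : n.-tuple RT * RT => synthetic_div p.2 1 p.1 : n.-tuple RT).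
  by apply: (measurable_fun_synthetic_div ms2 _ ms1).
rewrite integral_exchange; last 2 first.
- apply/measurable_EFinP; apply: measurable_funM.
    exact: measurableT_comp mI ms2.
  exact: mf ms2 msd.

- by move=> a x; rewrite lee_fin mulr_ge0// mulr_ge0.
(* With x now in the outer integral, the quotient can be taken as the new variable for each fixed
   x. *)
rewrite [RHS]integral_mkcond; apply: eq_integral => x _.
rewrite /patch indicE; case: ifPn => xI; last first.
  by rewrite integral0_eq// => a _; rewrite mul0r.
rewrite restr -(@integral_synthetic_div n x 1 (fun a => (f x a)%:E)).
- by apply: eq_integral => a _; rewrite mul1r.
- by apply/measurable_EFinP; exact: mf.
- by move=> a; rewrite lee_fin.
Qed.

Lemma expected_real_zeros_primitive n (q : {poly R}) :
  (forall x : R, -1 <= x <= 1 ->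
     mean_Omega (fun a : n.-tuple R => `|(monic_poly a).[x]|) = (q^`()).[x] /\
     0 < (q^`()).[x]) ->
  expected_real_zeros R n.+1 = wbin R n./2 / 2 * (q.[1] - q.[-1]).
Proof.
move=> hq; have D0 := volume_Omega_gt0 R n; have w0 := wbin_gt0 R n./2.
rewrite /expected_real_zeros /mean_Omega /Rintegral integral_size_rootsR.
have h x : -1 <= x <= 1 ->
    (\int[lebt n]_(a in @Omega R n) `|(monic_poly a).[x]|%:E)%E =
    ((volume_Omega R n)%:E * ((q^`()).[x])%:E)%E.
  move=> /hq [e q0]; move: e; rewrite /mean_Omega /Rintegral.
  set I := integral _ _ _ => e.
  (* [fine] sends an infinite integral to 0, so the positivity of the assumed mean is what shows
     that the integral is finite. *)
  have fI : I \is a fin_num.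
    have I0 : (0 <= I)%E by apply: integral_ge0 => a _; rewrite lee_fin.
    rewrite ge0_fin_numE// ltey; apply/eqP => Ioo.
    by move: q0; rewrite -e Ioo mulr0 ltxx.
  by rewrite -(fineK fI) -EFinM -e mulrA mulfV ?gt_eqF// mul1r.
have -> : (\int[leb]_(x in `[(-1 : R)%R, 1%R])
     \int[lebt n]_(a in @Omega R n) `|(monic_poly a).[x]|%:E =
   (volume_Omega R n * (q.[1] - q.[-1]))%:E)%E.
  have N11 : (-1 : R) < 1 by lra.
  rewrite EFinM -(integral_deriv_poly q N11) -ge0_integralZl//; last 3 first.
  - by apply/measurable_EFinP; apply: measurable_funTS; exact: measurable_horner.
  - move=> x /=; rewrite in_itv/= => /hq [_ q0]; rewrite lee_fin; exact: ltW.
  - by rewrite lee_fin ltW.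
  by apply: eq_integral => x; rewrite mem_setE in_itv/= => /h.
rewrite /= volume_Omega_rec; field.
by rewrite !gt_eqF.
Qed.

(** Written with [pbin], the assumed means have a single shape, with n = m or m + 1 according to the
    parity of N. Their prefactor 1 / w m cancels against the volume ratio w m / 2 and the 2 that
    integrating an even polynomial over [-1, 1] produces. *)
Lemma expected_real_zeros_double_sum N m n : N./2 = m ->
  (forall x : R, -1 <= x <= 1 ->
     mean_Omega (fun a : N.-tuple R => `|(monic_poly a).[x]|) =
     (wbin R m)^-1 *
     (\sum_(k < m.+1) wbin R (m - k) * pbin R k * x ^+ (2 * k)) *
     (\sum_(j < n.+1) pbin R (n - j) * pbin R j * x ^+ (2 * j))) ->
  expected_real_zeros R N.+1 = double_sum R m n.
Proof.
move=> Nm hN; have w0 := wbin_gt0 R m.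
pose c k j : R := wbin R (m - k) * pbin R k * (pbin R (n - j) * pbin R j).
pose q : {poly R} := (wbin R m)^-1 *: \sum_(k < m.+1) \sum_(j < n.+1)
   (c k j / (2 * k%:R + 2 * j%:R + 1)) *: 'X^((2 * k + 2 * j).+1).
have q' x : (q^`()).[x] = (wbin R m)^-1 *
     (\sum_(k < m.+1) wbin R (m - k) * pbin R k * x ^+ (2 * k)) *
     (\sum_(j < n.+1) pbin R (n - j) * pbin R j * x ^+ (2 * j)).
  rewrite /q derivZ hornerZ -mulrA; congr (_ * _).
  rewrite linear_sum/= horner_sum mulr_suml; apply: eq_bigr => k _.
  rewrite linear_sum/= horner_sum mulr_sumr; apply: eq_bigr => j _.
  rewrite derivZ derivXn/= hornerZ hornerMn hornerXn exprD.
  have k0 := ler0n R k; have j0 := ler0n R j.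
  rewrite -[X in _ * X = _]mulr_natr -[(2 * k + 2 * j).+1%:R]natr1 natrD !natrM /c.
  field.
  by apply/eqP; lra.
rewrite (@expected_real_zeros_primitive _ q) => [|x x1]; last first.
  split; first by rewrite hN.
  have pos (k : nat) (a : nat -> R) : (forall i, 0 < a i) ->
      0 < \sum_(i < k.+1) a i * x ^+ (2 * i).
    move=> a0; rewrite big_ord_recl/= muln0 expr0 mulr1 ltr_wpDr//.
    apply: sumr_ge0 => i _; rewrite mulr_ge0 ?(ltW (a0 _))//.
    by rewrite mulnC exprM sqr_ge0.
  have p1 := pos m (fun k => wbin R (m - k) * pbin R k).
  have p2 := pos n (fun j => pbin R (n - j) * pbin R j).
  rewrite q' !mulr_gt0 ?invr_gt0 ?p1 ?p2// => i; by rewrite mulr_gt0 ?wbin_gt0 ?pbin_gt0.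
have q1 : q.[1] = (wbin R m)^-1 * double_sum R m n.
  rewrite /q hornerZ; congr (_ * _); rewrite /double_sum horner_sum.
  apply: eq_bigr => k _; rewrite horner_sum mulr_sumr; apply: eq_bigr => j _.
  by rewrite hornerZ hornerXn expr1n mulr1 /c -[LHS]mulrA.
have qN1 : q.[-1] = - q.[1].
  rewrite /q !hornerZ -mulrN; congr (_ * _); rewrite !horner_sum -sumrN.
  apply: eq_bigr => k _; rewrite !horner_sum -sumrN; apply: eq_bigr => j _.
  rewrite !hornerZ !hornerXn -mulrN expr1n; congr (_ * _).
  by rewrite -mulnDr exprS exprM sqrrN !expr1n mulr1.
rewrite qN1 q1 Nm; field.
by rewrite gt_eqF.
Qed.

End Expectation.

(** * The assumed formulas in terms of normalized binomials *)

Section HypothesisSums.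
Variable R : realFieldType.
Implicit Types (m k : nat) (x : R).

Lemma bin_doubleE k : 'C(2 * k, k)%:R = pbin R k * 4 ^+ k.
Proof. by rewrite /pbin divfK// expf_neq0// pnatr_eq0. Qed.

Lemma sum_bin_bin m x :
  \sum_(k < m.+1) 'C(2 * m - 2 * k, m - k)%:R * 'C(2 * k, k)%:R * x ^+ (2 * k) =
  4 ^+ m * \sum_(k < m.+1) pbin R (m - k) * pbin R k * x ^+ (2 * k).
Proof.
rewrite mulr_sumr; apply: eq_bigr => k _; have km : (k <= m)%N by rewrite -ltnS.
have -> : (4 ^+ m = 4 ^+ (m - k) * 4 ^+ k :> R) by rewrite -exprD subnK.
by rewrite -mulnBr !bin_doubleE; ring.
Qed.

Lemma sum_weighted_bin_bin m x :
  \sum_(k < m.+1) (2 * m - 2 * k + 1)%:R / (2 * m + 1)%:R *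
    'C(2 * m - 2 * k, m - k)%:R * 'C(2 * k, k)%:R * x ^+ (2 * k) =
  4 ^+ m / (2 * m%:R + 1) *
  \sum_(k < m.+1) wbin R (m - k) * pbin R k * x ^+ (2 * k).
Proof.
rewrite mulr_sumr; apply: eq_bigr => k _; have km : (k <= m)%N by rewrite -ltnS.
have -> : (4 ^+ m = 4 ^+ (m - k) * 4 ^+ k :> R) by rewrite -exprD subnK.
by rewrite -mulnBr !bin_doubleE /wbin !addn1 -![(2 * _).+1%:R]natr1 !natrM; ring.
Qed.

End HypothesisSums.

Theorem theorem1p14 (R : realType)
  (Heven : forall (m : nat) (T : R), -1 <= T <= 1 ->
    mean_Omega (fun a : (2 * m).-tuple R => `|(monic_poly a).[T]|) =
    1 / (2 ^+ (2 * m) * 'C(2 * m, m)%:R)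
    * (\sum_(k < m.+1)
         (2 * m - 2 * k + 1)%:R / (2 * m + 1)%:R
         * 'C(2 * m - 2 * k, m - k)%:R * 'C(2 * k, k)%:R * T ^+ (2 * k))
    * (\sum_(k < m.+1)
         'C(2 * m - 2 * k, m - k)%:R * 'C(2 * k, k)%:R * T ^+ (2 * k)))
  (Hodd : forall (m : nat) (T : R), -1 <= T <= 1 ->
    mean_Omega (fun a : (2 * m + 1).-tuple R => `|(monic_poly a).[T]|) =
    1 / (2 ^+ (2 * m + 2) * 'C(2 * m, m)%:R)
    * (\sum_(k < m.+1)
         (2 * m - 2 * k + 1)%:R / (2 * m + 1)%:R
         * 'C(2 * m - 2 * k, m - k)%:R * 'C(2 * k, k)%:R * T ^+ (2 * k))
    * (\sum_(k < m.+2)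
         'C(2 * m + 2 - 2 * k, m + 1 - k)%:R * 'C(2 * k, k)%:R
         * T ^+ (2 * k))) :
  (fun N : nat => expected_real_zeros R N / (1 / pi * ln N%:R)) @ \oo --> (1 : R).
Proof.
have four m : 2 ^+ (2 * m) = 4 ^+ m :> R.
  by rewrite exprM; congr (_ ^+ m); ring.
have q0 m : 4 ^+ m != 0 :> R by rewrite expf_neq0// pnatr_eq0.
apply: double_sum_asymptotics => m; have m0 := ler0n R m; have p0 := pbin_gt0 R m.
(* Degree 2 m + 1 uses the mean in degree 2 m: one degree is taken by the real root. *)
- rewrite addn1; apply: expected_real_zeros_double_sum => [|x x1].
    by rewrite mul2n doubleK.
  rewrite Heven// sum_weighted_bin_bin sum_bin_bin four bin_doubleE /wbin.
  by field; rewrite q0 andbT gt_eqF//=; apply/eqP; lra.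
- have -> : (2 * m + 2 = (2 * m + 1).+1)%N by lia.
  apply: expected_real_zeros_double_sum => [|x x1]; first by lia.
  rewrite Hodd// sum_weighted_bin_bin.
  have -> : (2 * m + 2 = 2 * m.+1)%N by lia.
  (* The prefactor 2^(2 m + 2) is absorbed by the 4^(m + 1) that the longer second sum yields, so
     the same 1 / w m remains. *)
  rewrite addn1 sum_bin_bin four bin_doubleE exprS /wbin.
  by field; rewrite q0 andbT gt_eqF//=; apply/eqP; lra.
Qed.
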